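(* Let $\Delta$ be a unit interval pure $(m-1)$-dimensional simplicial complex on $[n]$, with determinantal facet ideal $J_\Delta$. Let $\mathcal G$ be the set of all binomials of types (1), (2), (3) described in the context, and let $\mathcal G'$ be the set of all binomials of type (3). With respect to the monomial order $\succ$ on $R[\mathbf T_\Delta]$ and on $\mathbb K[\mathbf T_\Delta]$, the set $\mathcal G$ is a Gröbner basis of the presentation ideal $\ker\phi^*$ of $\mathcal R(\mathrm{in}_>(J_\Delta))$, and $\mathcal G'$ is a Gröbner basis of the presentation ideal $\ker\psi^*$ of $\mathcal F(\mathrm{in}_>(J_\Delta))$. In particular, $\mathrm{in}_>(J_\Delta)$ is of fiber type.
   Context: Let $\mathbb K$ be a field, $m\le n$ positive integers, $X=(x_{ij})$ an $m\times n$ matrix of indeterminates and $R=\mathbb K[X]$. Let $\Delta$ be a pure $(m-1)$-dimensional simplicial complex on $[n]=\{1,\dots,n\}$; its $(m-1)$-dimensional faces (facets) are identified with $m$-subsets $\mathbf a=\{a_1<\dots<a_m\}$. A clique of $\Delta$ is an induced subcomplex any $m$ vertices of which lie together in a face; write $\Delta=\Delta_1\cup\dots\cup\Delta_r$ for the decomposition into maximal cliques (each with at least $m$ vertices). $\Delta$ is unit interval if the vertex set of each $\Delta_i$ is an interval $[u_i,v_i]=\{u_i,u_i+1,\dots,v_i\}$ with $u_i<v_i$, indexed so that $1=u_1<u_2<\dots<u_r$ and $v_r=n$. Thus an $m$-subset is a facet of $\Delta$ iff it is contained in some $[u_i,v_i]$; $\mathbf a\in\Delta_i$ means $\mathbf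 a\subseteq[u_i,v_i]$. For a facet $\mathbf a$, $i_a$ denotes the smallest index $i$ with $\mathbf a\in\Delta_i$ (similarly $i_b$ for $\mathbf b$). The clique complex $\Delta^{\mathrm{clique}}$ is the simplicial complex whose facets are the vertex sets $[u_i,v_i]$. $[\mathbf a]$ is the maximal minor of $X$ on columns $\mathbf a$, and $J_\Delta=([\mathbf a]:\mathbf a\text{ a facet of }\Delta)\subseteq R$. Let $>$ be the lexicographic order on $R$ with $x_{11}>x_{12}>\dots>x_{1n}>x_{21}>\dots>x_{mn}$, and $\mathbf x_{\mathbf a}=\mathrm{in}_>[\mathbf a]=x_{1a_1}\cdots x_{ma_m}$. The minors $[\mathbf a]$ ($\mathbf a$ a facet) form a Gröbner basis of $J_\Delta$ (known), so $\mathrm{in}_>(J_\Delta)=(\mathbf x_{\mathbf a}:\mathbf a\text{ a facet})$. Let $\mathbf T_\Delta=\{T_{\mathbf a}:\mathbf a\text{ a facet of }\Delta\}$ be new indeterminates. $\mathcal R(\mathrm{in}_>(J_\Delta))=R[\mathrm{in}_>(J_\Delta)t]\subseteq R[t]$ is the Rees algebra and $\mathcal F(\mathrm{in}_>(J_\Delta))$ is the special fiber ring, identified with $\mathbb K[\mathbf x_{\mathbf a}:\mathbf a\text{ a facet}]$. Presentations: $\phi^*:R[\mathbf T_\Delta]\to\mathcal R(\mathrm{in}_>(J_\Delta))$ is the $R$-algebra map with $T_{\mathbf a}\mapsto\mathbf x_{\mathbf a}t$; $\psi^*:\mathbb K[\mathbf T_\Delta]\to\mathcal F(\mathrm{in}_>(J_\Delta))$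 is the $\mathbb K$-algebra map with $T_{\mathbf a}\mapsto\mathbf x_{\mathbf a}$. $\mathrm{in}_>(J_\Delta)$ is of fiber type if $\ker\phi^*=\mathcal L^*+\ker\psi^*\cdot R[\mathbf T_\Delta]$, where $\mathcal L^*$ is the kernel of the natural surjection from $R[\mathbf T_\Delta]$ to the symmetric algebra of $\mathrm{in}_>(J_\Delta)$ (generated by the elements of $\ker\phi^*$ linear in the $T$-variables). Orders: $\mathbf a>\mathbf b$ lexicographically means $\mathbf x_{\mathbf a}>\mathbf x_{\mathbf b}$. $\succ$ is the degree reverse lexicographic order on $\mathbb K[\mathbf T_\Delta]$ and $R[\mathbf T_\Delta]$ induced by the following order of variables: $T_{\mathbf a}>T_{\mathbf b}$ if $\mathbf a>\mathbf b$ lexicographically; $T_{\mathbf a}>x_{ij}$ for all $\mathbf a,i,j$; $x_{ij}>x_{pq}$ if $i<p$, or $i=p$ and $j<q$. The Plücker poset is the set of $m$-subsets of $[n]$ with $\mathbf a\le_p\mathbf b$ iff $a_i\le b_i$ for all $i$; comparable/incomparable refers to $\le_p$. For $m$-subsets, $\min\{\mathbf a,\mathbf b\}=\{\min\{a_1,b_1\},\dots,\min\{a_m,b_m\}\}$ and $\max\{\mathbf a,\mathbf b\}$ is defined analogously. The binomials: (1) $\mathbf x_{\mathbf a}T_{\mathbf b}-\mathbf x_{\mathbf b}T_{\mathbf a}$, for facets $\mathbf a,\mathbf b$ of $\Delta$ with $i_a<i_b$, $\mathbf a\notin\Delta_{i_b}$, $\mathbf a>\mathbf b$ lexicographically, and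 $\mathbf a,\mathbf b$ comparable; (2) $x_{ic_i}T_{\mathbf c\setminus c_i}-x_{ic_{i+1}}T_{\mathbf c\setminus c_{i+1}}$, for $\mathbf c=\{c_1<\dots<c_{m+1}\}$ an $m$-dimensional face of $\Delta^{\mathrm{clique}}$ and $1\le i\le m$; (3) $T_{\mathbf a}T_{\mathbf b}-T_{\mathbf c}T_{\mathbf d}$, for facets $\mathbf a,\mathbf b$ of $\Delta$ that are incomparable, with $\mathbf c=\min\{\mathbf a,\mathbf b\}$ and $\mathbf d=\max\{\mathbf a,\mathbf b\}$ (these are again facets of $\Delta$). *)

(* Defs.v *)
From HB Require Import structures.
From mathcomp Require Import all_boot all_order all_algebra.
From mathcomp Require Import mpoly.
From mathcomp Require monalg.

Set Implicit Arguments.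
Unset Strict Implicit.
Unset Printing Implicit Defensive.
Import Order.TTheory GRing.Theory.
Local Open Scope ring_scope.

(* The polynomial ring K[V] on a finite type V of indeterminates is
   {mpoly K[#|V|]}, the indeterminate v : V being number [enum_rank v]. *)
Definition polyring (K : nzRingType) (V : finType) := {mpoly K[#|V|]}.

Definition var (K : nzRingType) (V : finType) (v : V) : {mpoly K[#|V|]} :=
  'X_(enum_rank v).

Definition subst (K : nzRingType) (V : finType) (A : nzRingType)
    (c : K -> A) (h : V -> A) (f : {mpoly K[#|V|]}) : A :=
  mmap c (fun k => h (enum_val k)) f.

Definition incl (K : nzRingType) (V W : finType) (g : V -> W)
    (f : {mpoly K[#|V|]}) : {mpoly K[#|W|]} :=
  subst (@mpolyC #|W| K) (fun v => var K (g v)) f.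

Definition expo (V : finType) (p : 'X_{1..#|V|}) (v : V) : nat :=
  p (enum_rank v).

(* In both orders [gt] is the strict order on the indeterminates
   ([gt v w] means v > w), and the result is the strict relation p < q. *)
Definition lex_lt (V : finType) (gt : rel V) (p q : 'X_{1..#|V|}) : bool :=
  [exists v, (expo p v < expo q v)%N &&
             [forall w, gt w v ==> (expo p w == expo q w)]].

Definition degrevlex_lt (V : finType) (gt : rel V) (p q : 'X_{1..#|V|})
    : bool :=
  (mdeg p < mdeg q)%N ||
  ((mdeg p == mdeg q) &&
   [exists v, (expo q v < expo p v)%N &&
              [forall w, gt v w ==> (expo p w == expo q w)]]).

Definition ideal_gen (A : comNzRingType) (P : A -> Prop) (f : A) : Prop :=
  exists s : seq (A * A),
    (forall p, p \in s -> P p.2) /\ f = \sum_(p <- s) p.1 * p.2.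

Definition leading_monomial (N : nat) (K : nzRingType) (lt : rel 'X_{1..N})
    (f : {mpoly K[N]}) (p : 'X_{1..N}) : Prop :=
  p \in msupp f /\ (forall q, q \in msupp f -> q != p -> lt q p).

Definition initial_ideal (N : nat) (K : comNzRingType) (lt : rel 'X_{1..N})
    (P : {mpoly K[N]} -> Prop) : {mpoly K[N]} -> Prop :=
  ideal_gen (fun q => exists f p,
    [/\ P f, leading_monomial lt f p & q = 'X_[p]]).

Definition groebner_basis (N : nat) (K : comNzRingType) (lt : rel 'X_{1..N})
    (G I : {mpoly K[N]} -> Prop) : Prop :=
  [/\ exists s : seq {mpoly K[N]}, forall g, G g -> g \in s,
      forall g, G g -> I g
    & forall f, initial_ideal lt G f <-> initial_ideal lt I f].

(* Symmetric algebra of an ideal I of A, presented as the polynomial A-algebra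
   on symbols e_u (u in A) modulo e_w for w outside I and
   e_(r u + v) - r e_u - e_v for u, v in I.  [monalg] is imported locally since
   its notations clash with those of [mpoly]. *)
Module Sym.
Import monalg.
Section Sym.
Context (A : comNzRingType).

Definition free : comAlgType A := {malg A[{cmonom A}]}.

Definition e (u : A) : free := mkmalgU (ucm u) 1.

Definition relation (I : A -> Prop) (f : free) : Prop :=
  (exists2 w, ~ I w & f = e w) \/
  (exists r u v, [/\ I u, I v & f = e (r * u + v) - r *: e u - e v]).

Definition eq0 (I : A -> Prop) : free -> Prop := ideal_gen (relation I).

End Sym.
End Sym.

(* The paper's [n] = {1..n} is 'I_n = {0..n-1}, and all 1-based indices are
   shifted accordingly. *)
Definition ksubset (n k : nat) : finType := {a : {set 'I_n} | #|a| == k}.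

(* [elt a i] is a_i; [enum_val] enumerates a set of ordinals increasingly. *)
Definition elt (n k : nat) (a : ksubset n k) (i : 'I_k) : 'I_n :=
  enum_val (cast_ord (esym (eqP (valP a))) i).

Section Complexes.
Context (n m : nat).
Implicit Types (D : {set {set 'I_n}}) (S : {set 'I_n}).

Definition simplicial_complex D : Prop :=
  set0 \in D /\ (forall F E : {set 'I_n}, F \in D -> E \subset F -> E \in D).

Definition pure D : Prop :=
  forall F, maxset (fun E : {set 'I_n} => E \in D) F -> #|F| = m.

Definition clique D S : bool :=
  [forall E : {set 'I_n}, (E \subset S) && (#|E| == m) ==>
    [exists F in D, E \subset F]].

(* A set of fewer than m vertices is vacuously a clique, whence the bound. *)
Definition maximal_clique D S : bool :=
  maxset (fun E : {set 'I_n} => (m <= #|E|)%N && clique D E) S.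

Definition interval (u v : 'I_n) : {set 'I_n} :=
  [set j : 'I_n | (u <= j <= v)%N].

Definition unit_interval D (r : nat) (u v : 'I_r.+1 -> 'I_n) : Prop :=
  [/\ forall S, maximal_clique D S <-> exists i, S = interval (u i) (v i),
      forall i, (u i < v i)%N,
      forall i j : 'I_r.+1, (i < j)%N -> (u i < u j)%N,
      u ord0 = 0%N :> nat
    & (v ord_max).+1 = n].

Definition facet D : finType := {a : ksubset n m | val a \in D}.

Definition pluecker_le (a b : ksubset n m) : bool :=
  [forall i, (elt a i <= elt b i)%N].

Definition comparable (a b : ksubset n m) : bool :=
  pluecker_le a b || pluecker_le b a.

Definition set_min (a b : ksubset n m) : {set 'I_n} :=
  [set Order.min (elt a i) (elt b i) | i : 'I_m].

Definition set_max (a b : ksubset n m) : {set 'I_n} :=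
  [set Order.max (elt a i) (elt b i) | i : 'I_m].

Definition Xidx : finType := ('I_m * 'I_n)%type.

Definition x_gt : rel Xidx :=
  fun p q => (p.1 < q.1)%N || ((p.1 == q.1) && (p.2 < q.2)%N).

Definition x_lt : rel 'X_{1..#|Xidx|} := lex_lt x_gt.

(* exponent of x_a = x_(1 a_1) ... x_(m a_m) *)
Definition diag_mnm (a : ksubset n m) : 'X_{1..#|Xidx|} :=
  (\sum_(i < m) U_(enum_rank ((i, elt a i) : Xidx)))%MM.

Definition lex_gt (a b : ksubset n m) : bool := x_lt (diag_mnm b) (diag_mnm a).

Definition XTidx D : finType := (Xidx + facet D)%type.

Definition T_gt D : rel (facet D) := fun a b => lex_gt (val a) (val b).

Definition XT_gt D : rel (XTidx D) := fun p q =>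
  match p, q with
  | inr a, inr b => T_gt a b
  | inr _, inl _ => true
  | inl _, inr _ => false
  | inl x, inl y => x_gt x y
  end.

Definition T_lt D : rel 'X_{1..#|facet D|} := degrevlex_lt (@T_gt D).
Definition XT_lt D : rel 'X_{1..#|XTidx D|} := degrevlex_lt (@XT_gt D).

End Complexes.

Section Algebras.
Context (K : fieldType) (m n : nat) (D : {set {set 'I_n}}).

Definition R := polyring K (Xidx n m).
Definition KT := polyring K (facet m D).
Definition RT := polyring K (XTidx m D).

Definition x_ (i : 'I_m) (j : 'I_n) : R := var K ((i, j) : Xidx n m).

Definition xmon (a : ksubset n m) : R := 'X_[diag_mnm a].

Definition minor (a : ksubset n m) : R := \det (\matrix_(i, j) x_ i (elt a j)).

Definition J : R -> Prop :=
  ideal_gen (fun f => exists a : facet m D, f = minor (val a)).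

Definition inJ : R -> Prop := initial_ideal (@x_lt n m) J.

Definition R_in_RT : R -> RT := incl inl.
Definition KT_in_RT : KT -> RT := incl inr.

Definition T_ (a : facet m D) : KT := var K a.
Definition xRT (i : 'I_m) (j : 'I_n) : RT := R_in_RT (x_ i j).
Definition TRT (a : facet m D) : RT := KT_in_RT (T_ a).

(* The Rees algebra is a subring of R[t] = {poly R}, and phi* lands in it. *)
Definition phi : RT -> {poly R} :=
  subst (@polyC R \o @mpolyC _ K) (fun p : XTidx m D =>
    match p with
    | inl ij => (x_ ij.1 ij.2)%:P
    | inr a => (xmon (val a))%:P * 'X
    end).

Definition ker_phi (f : RT) : Prop := phi f = 0.

Definition psi : KT -> R :=
  subst (@mpolyC _ K) (fun a : facet m D => xmon (val a)).

Definition ker_psi (f : KT) : Prop := psi f = 0.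

(* lift to the free algebra of the surjection of R[T] onto Sym(in(J)),
   T_a |-> e_(x_a) *)
Definition to_sym : RT -> Sym.free R :=
  subst (in_alg (Sym.free R) \o @mpolyC _ K) (fun p : XTidx m D =>
    match p with
    | inl ij => (x_ ij.1 ij.2)%:A
    | inr a => Sym.e (xmon (val a))
    end).

Definition L (f : RT) : Prop := Sym.eq0 inJ (to_sym f).

Definition fiber_type : Prop :=
  forall f : RT, ker_phi f <->
    exists g h : RT,
      [/\ L g,
          ideal_gen (fun q => exists2 p, ker_psi p & q = KT_in_RT p) h
        & f = g + h].

Section Binomials.
Context (r : nat) (u v : 'I_r.+1 -> 'I_n).

Definition in_clique (a : facet m D) (i : 'I_r.+1) : bool :=
  val (val a) \subset interval (u i) (v i).

(* i = i_a *)
Definition first_clique (a : facet m D) (i : 'I_r.+1) : bool :=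
  in_clique a i && [forall j, in_clique a j ==> (i <= j)%N].

Definition clique_complex_face (F : {set 'I_n}) : bool :=
  [exists i, F \subset interval (u i) (v i)].

Definition binom1 (f : RT) : Prop :=
  exists (a b : facet m D) (ia ib : 'I_r.+1),
    [/\ [/\ first_clique a ia, first_clique b ib & (ia < ib)%N],
        ~~ in_clique a ib,
        lex_gt (val a) (val b),
        comparable (val a) (val b)
      & f = R_in_RT (xmon (val a)) * TRT b - R_in_RT (xmon (val b)) * TRT a].

(* p = c \ c_i and q = c \ c_(i+1) *)
Definition binom2 (f : RT) : Prop :=
  exists (c : ksubset n m.+1) (i : 'I_m) (p q : facet m D),
    let ci := elt c (widen_ord (leqnSn m) i) in
    let ci1 := elt c (lift ord0 i) in
    [/\ clique_complex_face (val c),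
        val (val p) = val c :\ ci,
        val (val q) = val c :\ ci1
      & f = xRT i ci * TRT p - xRT i ci1 * TRT q].

(* stated over any ring containing the T_a, for use in K[T] and R[T] *)
Definition binom3 (S : nzRingType) (T : facet m D -> S) (f : S) : Prop :=
  exists a b c d : facet m D,
    [/\ ~~ comparable (val a) (val b),
        val (val c) = set_min (val a) (val b),
        val (val d) = set_max (val a) (val b)
      & f = T a * T b - T c * T d].

Definition G (f : RT) : Prop := [\/ binom1 f, binom2 f | binom3 TRT f].

Definition G' (f : KT) : Prop := binom3 T_ f.

End Binomials.
End Algebras.

(* Main.v *)
From HB Require Import structures.
From mathcomp Require Import all_boot all_order all_algebra all_fingroup.
From mathcomp Require Import mpoly zify.
From mathcomp Require monalg finmap.
From Stdlib Require Import Classical ClassicalEpsilon.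
Require Import Defs.

Set Implicit Arguments.
Unset Strict Implicit.
Unset Printing Implicit Defensive.
Import Order.TTheory GRing.Theory.
Local Open Scope ring_scope.

(** Both presentation ideals are toric: phi* and psi* send monomials to
    monomials, so that the kernels are spanned by the differences of two monomials
    in one fibre of the induced map on exponents.  A set of such differences is
    therefore a Gröbner basis as soon as among any two distinct monomials of a
    fibre one is divisible by a leading term of the set: descending from the
    smaller of two terms of a kernel element inside their fibre then forces the
    larger one to be divisible ([groebner_of_fibres]).  The same hypothesis shows
    that the set generates the kernel ([gen_of_fibres]).

    What has to be proved is that a fibre contains at most one standard monomial
    x^al T_(a^1) ... T_(a^s), that is, one divisible by no leading term.  By
    the binomials (3) the facets a^k form a chain for the Plücker order; for psi*
    the chain is recovered by sorting each row.  For phi*, compare the least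
    elements a and b of the chains of two standard monomials of a fibre.
    Whenever b_i < a_i, the entry b_i of the row i occurs in the fibre but not
    in the chain of a, so x_(i b_i) divides the first monomial, and symmetrically.
    The binomials (2) forbid a variable x_(i y) whose column fits between
    a_(i-1) and a_i inside a clique of a.  Hence a and b can differ for the
    first time only in the first row, say b_1 < a_1 with b_1 outside of all
    cliques of a.  Using (2) again, b_i < a_i in every row: an equality in one row
    would spread to the last row, and then the clique of b would contain a and
    b_1.  So all of x_b divides the first monomial, which (1) forbids.  Thus
    a = b, the factor T_a cancels, and induction on s concludes
    ([x_irreducible_first_difference], [standard_unique]).

    For the fiber type property, the binomials (1) and (2) are syzygies, hence lie
    in the ideal L*, and the binomials (3) come from ker psi*.  Since (1), (2), (3)
    generate ker phi*, this gives one inclusion.  The other one holds because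
    Sym maps to the Rees algebra by sending the symbol of u to u t.  Both use that
    x_a is the initial term of the minor [a] and so lies in the initial ideal. *)

(** * Ideals generated by a predicate *)

Section IdealGen.
Context (A : comNzRingType).
Implicit Types (P Q : A -> Prop) (f g : A).

Lemma ideal_gen0 P : ideal_gen P 0.
Proof. by exists [::]; split=> //; rewrite big_nil. Qed.

Lemma ideal_genD P f g : ideal_gen P f -> ideal_gen P g -> ideal_gen P (f + g).
Proof.
move=> [s [Ps ->]] [t [Pt ->]]; exists (s ++ t); split; last by rewrite big_cat.
by move=> p; rewrite mem_cat => /orP[/Ps | /Pt].
Qed.

Lemma ideal_genMl P f g : ideal_gen P g -> ideal_gen P (f * g).
Proof.
move=> [s [Ps ->]]; exists [seq (f * p.1, p.2) | p <- s]; split.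
  by move=> _ /mapP[p /Ps Pp ->].
by rewrite mulr_sumr big_map; apply: eq_bigr => p _; rewrite mulrA.
Qed.

Lemma ideal_genN P f : ideal_gen P f -> ideal_gen P (- f).
Proof. by rewrite -mulN1r; apply: ideal_genMl. Qed.

Lemma ideal_gen_id P f : P f -> ideal_gen P f.
Proof.
move=> Pf; exists [:: (1, f)]; split; last by rewrite big_seq1 mul1r.
by move=> p; rewrite inE => /eqP->.
Qed.

Lemma ideal_gen_ind P Q f :
    Q 0 -> (forall g h, Q g -> Q h -> Q (g + h)) ->
    (forall g h, P h -> Q (g * h)) ->
  ideal_gen P f -> Q f.
Proof.
move=> Q0 QD QM [s [Ps ->]].
elim: s Ps => [|p s IHs] Ps; first by rewrite big_nil.
rewrite big_cons; apply: QD; first by apply/QM/Ps; rewrite mem_head.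
by apply: IHs => q qs; apply: Ps; rewrite inE qs orbT.
Qed.

Lemma ideal_genS P Q f :
  (forall g, P g -> ideal_gen Q g) -> ideal_gen P f -> ideal_gen Q f.
Proof.
move=> PQ; apply: ideal_gen_ind; [exact: ideal_gen0 | exact: ideal_genD |].
by move=> g h /PQ; apply: ideal_genMl.
Qed.

End IdealGen.

(** * Gröbner bases of binomial ideals *)

Section Fibres.
Context (N : nat) (K : fieldType) (T : eqType).
Context (lt : rel 'X_{1..N}) (pi : 'X_{1..N} -> T).
Context (G I : {mpoly K[N]} -> Prop).

Hypothesis lt_irr : irreflexive lt.
Hypothesis lt_trans : transitive lt.
Hypothesis lt_deg : forall p q, lt p q -> (mdeg p <= mdeg q)%N.
Hypothesis lt_add : forall s p q, lt p q -> lt (p + s)%MM (q + s)%MM.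
Hypothesis pi_add :
  forall s p q, pi p = pi q -> pi (p + s)%MM = pi (q + s)%MM.

Definition fibre_binomial (g : {mpoly K[N]}) : Prop :=
  exists p q, [/\ lt q p, pi q = pi p & g = 'X_[p] - 'X_[q]].

(** Divisibility by the leading term of a fibre binomial in [G]. *)
Definition reducible (p : 'X_{1..N}) : Prop :=
  exists p0 q0, [/\ lt q0 p0, pi q0 = pi p0, G ('X_[p0] - 'X_[q0])
                  & (p0 <= p)%MM].

Hypothesis G_binomial : forall g, G g -> fibre_binomial g.
Hypothesis ID : forall f g, I f -> I g -> I (f + g).
Hypothesis IM : forall f g, I g -> I (f * g).
Hypothesis I_fibre : forall p q, pi p = pi q -> I ('X_[p] - 'X_[q]).
Hypothesis I_supp : forall f p, I f -> p \in msupp f ->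
  exists q, [/\ q \in msupp f, q != p & pi q = pi p].
Hypothesis fibre_reducible : forall p q, p != q -> pi p = pi q ->
  reducible p \/ reducible q.

(** [lt] is well founded because below a monomial there are only
    monomials of bounded degree, hence finitely many. *)
Lemma lt_ind (P : 'X_{1..N} -> Prop) :
  (forall p, (forall q, lt q p -> P q) -> P p) -> forall p, P p.
Proof.
move=> IH p; move: (leqnn (mdeg p)); move: {2}(mdeg p) => d le_pd.
pose below q := [set x : 'X_{1..N < d.+1} | lt (bmnm x) q].
have [k] := ubnP #|below p|; elim: k p le_pd => // k IHk p le_pd lt_k.
apply: IH => q lt_qp; have le_qd := leq_trans (lt_deg lt_qp) le_pd.
apply: IHk => //; apply: leq_trans (_ : _ <= #|below p|)%N _ => //.
apply: proper_card; apply/properP; split.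
  by apply/subsetP => x; rewrite !inE => /lt_trans; apply.
exists (@BMultinom _ d.+1 q le_qd); first by rewrite inE.
by rewrite inE lt_irr.
Qed.

Lemma binomial_lead p q : lt q p -> leading_monomial lt ('X_[K, p] - 'X_[q]) p.
Proof.
move=> lt_qp; have ne_qp : q != p by apply: contraTneq lt_qp => ->; rewrite lt_irr.
split.
  by rewrite mcoeff_msupp mcoeffB !mcoeffX eqxx (negPf ne_qp) subr0 oner_eq0.
move=> s; rewrite mcoeff_msupp mcoeffB !mcoeffX.
rewrite [p == s]eq_sym; have [//|_] := eqVneq s p.
by have [<-//|_] := eqVneq q s; rewrite subrr eqxx.
Qed.

Lemma G_sub_I g : G g -> I g.
Proof. by case/G_binomial => p [q [_ epq ->]]; apply: I_fibre. Qed.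

Lemma reducible_step p : reducible p ->
  exists q, [/\ lt q p, pi q = pi p & ideal_gen G ('X_[p] - 'X_[q])].
Proof.
move=> [p0 [q0 [lt0 pi0 G0 le_p0]]].
rewrite -(submK le_p0) addmC; exists (q0 + (p - p0))%MM.
split; [exact: lt_add | exact: pi_add |].
by rewrite !mpolyXD -mulrBl mulrC; apply/ideal_genMl/ideal_gen_id.
Qed.

(** Reducing q inside the fibre stays below p, so the two never meet; the descent
    ends, and then p is the one of the two that is reducible. *)
Lemma fibre_max_reducible p q : lt q p -> pi q = pi p -> reducible p.
Proof.
elim/lt_ind: q => q IHq lt_qp pi_qp.
have ne_qp : q != p by apply: contraTneq lt_qp => ->; rewrite lt_irr.
have [/reducible_step[s [lt_sq pi_sq _]]|//] := fibre_reducible ne_qp pi_qp.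
by apply: IHq lt_sq (lt_trans lt_sq lt_qp) _; rewrite pi_sq.
Qed.

(** The leading term of a kernel element shares its fibre with a smaller term
    of this element, so [fibre_max_reducible] applies to it. *)
Lemma groebner_of_fibres :
  (exists s : seq {mpoly K[N]}, forall g, G g -> g \in s) ->
  groebner_basis lt G I.
Proof.
move=> Gfin; split=> //; first exact: G_sub_I.
move=> f; split; apply: ideal_genS => h [g [p [Gg lead_p ->]]].
  by apply: ideal_gen_id; exists g, p; split=> //; apply: G_sub_I.
have [p_supp lt_p] := lead_p.
have [q [q_supp ne_qp pi_qp]] := I_supp Gg p_supp.
have [p0 [q0 [lt0 pi0 G0 le_p0]]] := fibre_max_reducible (lt_p q q_supp ne_qp) pi_qp.
rewrite -(submK le_p0) mpolyXD; apply/ideal_genMl/ideal_gen_id.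
by exists ('X_[p0] - 'X_[q0]), p0; split=> //; apply: binomial_lead.
Qed.

(** Two monomials of a fibre are reduced until they meet. *)
Lemma fibre_binomial_gen p q : pi p = pi q -> ideal_gen G ('X_[p] - 'X_[q]).
Proof.
elim/lt_ind: p q => p IHp q; elim/lt_ind: q => q IHq pi_pq.
have [->|ne_pq] := eqVneq p q; first by rewrite subrr; apply: ideal_gen0.
have [] := fibre_reducible ne_pq pi_pq.
  move=> /reducible_step[s [lt_s pi_s Gs]].
  rewrite -(subrK 'X_[s] 'X_[p]) -addrA; apply: ideal_genD => //.
  by apply: IHp => //; rewrite pi_s.
move=> /reducible_step[s [lt_s pi_s Gs]].
rewrite -(subrK 'X_[s] 'X_[p]) -addrA; apply: ideal_genD.
  by apply: IHq => //; rewrite pi_s.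
by rewrite -opprB; apply: ideal_genN.
Qed.

(** Subtracting a multiple of a fibre binomial removes a term of f without
    creating a new one. *)
Lemma gen_of_fibres f : I f -> ideal_gen G f.
Proof.
have [k] := ubnP (size (msupp f)); elim: k f => // k IHk f lt_k If.
case Ef: (msupp f) => [|p s]; first by rewrite (msuppnil0 Ef); apply: ideal_gen0.
have fp : p \in msupp f by rewrite Ef mem_head.
have [q [fq ne_qp pi_qp]] := I_supp If fp.
pose g := (f@_p)%:MP * ('X_[p] - 'X_[q]) : {mpoly K[N]}.
have Gg : ideal_gen G g by apply/ideal_genMl/fibre_binomial_gen.
rewrite -(subrK g f); apply: ideal_genD => //; apply: IHk; last first.
  apply: ID => //; rewrite -mulN1r; apply: IM; apply: IM; exact: I_fibre.
apply: leq_trans (_ : size (msupp f) <= k)%N => //.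
have fgp : p \notin msupp (f - g).
  rewrite -mcoeff_eq0 mcoeffB mcoeffCM mcoeffB !mcoeffX eqxx (negPf ne_qp).
  by rewrite subr0 mulr1 subrr.
apply: (@leq_ltn_trans (size (rem p (msupp f)))); last first.
  by rewrite size_rem // ltn_predL Ef.
apply: uniq_leq_size (msupp_uniq _) _ => x fgx.
have ne_xp : x != p by apply: contraNneq fgp => <-.
rewrite (rem_filter _ (msupp_uniq f)) mem_filter /= ne_xp /=.
apply: contraTT fgx => fx; rewrite -mcoeff_eq0 mcoeffB mcoeffCM mcoeffB !mcoeffX.
have ne_qx : q != x by apply: contraNneq fx => <-.
rewrite eq_sym in ne_xp.
by rewrite (negPf ne_xp) (negPf ne_qx) subrr mulr0 subr0 mcoeff_eq0.
Qed.

End Fibres.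

(** * The degree reverse lexicographic order *)

Section Exponents.
Context (V : finType).
Implicit Types (p q s : 'X_{1..#|V|}) (v w : V).

Definition uvar v : 'X_{1..#|V|} := U_(enum_rank v)%MM.

Lemma expoD p q v : expo (p + q)%MM v = (expo p v + expo q v)%N.
Proof. exact: mnmDE. Qed.

Lemma expo_uvar v w : expo (uvar v) w = (v == w).
Proof. by rewrite /expo mnm1E (inj_eq enum_rank_inj). Qed.

Lemma expoP p q : (forall v, expo p v = expo q v) -> p = q.
Proof.
move=> eq_pq; apply/mnmP => i; have := eq_pq (enum_val i).
by rewrite /expo enum_valK.
Qed.

Lemma expo_lepP p q : (forall v, expo p v <= expo q v)%N -> (p <= q)%MM.
Proof.
move=> le_pq; apply/mnm_lepP => i; have := le_pq (enum_val i).
by rewrite /expo enum_valK.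
Qed.

Context (gt : rel V).

Lemma degrevlex_irr : irreflexive (degrevlex_lt gt).
Proof.
move=> p; rewrite /degrevlex_lt ltnn eqxx /=.
by apply/negbTE/existsPn => v; rewrite ltnn.
Qed.

Lemma degrevlex_deg p q : degrevlex_lt gt p q -> (mdeg p <= mdeg q)%N.
Proof. by case/orP => [/ltnW //|/andP[/eqP-> _]]. Qed.

Lemma degrevlex_add s p q :
  degrevlex_lt gt p q -> degrevlex_lt gt (p + s)%MM (q + s)%MM.
Proof.
rewrite /degrevlex_lt !mdegD ltn_add2r eqn_add2r.
case/orP=> [-> //|/andP[-> /existsP[v /andP[lt_v /forallP eq_v]]]].
apply/orP; right; apply/existsP; exists v; rewrite !expoD ltn_add2r lt_v /=.
by apply/forallP => w; rewrite !expoD eqn_add2r.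
Qed.

Lemma degrevlexI v p q : mdeg p = mdeg q -> (expo q v < expo p v)%N ->
  (forall w, gt v w -> expo p w = expo q w) -> degrevlex_lt gt p q.
Proof.
move=> eq_deg lt_v eq_w; rewrite /degrevlex_lt eq_deg eqxx ltnn /=.
apply/existsP; exists v; rewrite lt_v; apply/forallP => w.
by apply/implyP => /eq_w->.
Qed.

(** The smaller one of two products of two variables is the one that contains the
    smallest of the four variables. *)
Lemma degrevlex_exchange a b c d : a != d -> b != d ->
    (forall w, gt d w -> [&& w != a, w != b, w != c & w != d]) ->
  degrevlex_lt gt (uvar c + uvar d)%MM (uvar a + uvar b)%MM.
Proof.
move=> ad bd below; apply: (@degrevlexI d).
- by rewrite !mdegD !mdeg1.
- by rewrite !expoD !expo_uvar eqxx (negPf ad) (negPf bd) addn1.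
move=> w /below/and4P[wa wb wc wd].
by rewrite !expoD !expo_uvar ![_ == w]eq_sym !(negPf wa, negPf wb, negPf wc, negPf wd).
Qed.

Hypothesis gt_total : forall v w, v != w -> gt v w || gt w v.
Hypothesis gt_trans : transitive gt.

Lemma degrevlex_trans : transitive (degrevlex_lt gt).
Proof.
move=> q p s /orP[lt_pq /degrevlex_deg le_qs|/andP[/eqP deg_pq /existsP[v]]].
  by rewrite /degrevlex_lt (leq_trans lt_pq le_qs).
move=> /andP[lt_v /forallP eq_v].
rewrite {1}/degrevlex_lt -deg_pq => /orP[lt_ps|/andP[/eqP deg_ps /existsP[w]]].
  by rewrite /degrevlex_lt lt_ps.
move=> /andP[lt_w /forallP eq_w].
have {}eq_v x : gt v x -> expo p x = expo q x by move/(implyP (eq_v x))/eqP.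
have {}eq_w x : gt w x -> expo q x = expo s x by move/(implyP (eq_w x))/eqP.
have [eq_vw|] := eqVneq v w; last case/gt_total/orP => gt_vw.
- rewrite -eq_vw in lt_w eq_w; apply: (@degrevlexI v) => //.
    exact: ltn_trans lt_v.
  by move=> x gt_x; rewrite eq_v ?eq_w.
- apply: (@degrevlexI w) => //; first by rewrite eq_v.
  by move=> x gt_x; rewrite eq_v ?eq_w //; apply: gt_trans gt_x.
- apply: (@degrevlexI v) => //; first by rewrite -eq_w.
  by move=> x gt_x; rewrite eq_v ?eq_w //; apply: gt_trans gt_x.
Qed.

End Exponents.

(** * Subsets of an ordinal as increasing sequences *)

Definition increasing n k (f : 'I_k -> 'I_n) : Prop :=
  forall i j : 'I_k, (i < j)%N -> (f i < f j)%N.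

Lemma increasing_inj n k (f : 'I_k -> 'I_n) : increasing f -> injective f.
Proof.
move=> incf i j eq_f; apply: val_inj; apply/eqP.
by case: ltngtP => // /incf; rewrite eq_f ltnn.
Qed.

Lemma increasing_le n k (f : 'I_k -> 'I_n) : increasing f ->
  forall i j : 'I_k, (i <= j)%N -> (f i <= f j)%N.
Proof.
move=> incf i j; rewrite leq_eqVlt => /orP[/eqP/val_inj->//|/incf].
exact: ltnW.
Qed.

(** The position of a value is determined by the image alone; this is what makes
    increasing enumerations unique. *)
Lemma card_increasing_below n k (f : 'I_k -> 'I_n) (i : 'I_k) : increasing f ->
  #|[set y in f @: setT | (y < f i)%N]| = i.
Proof.
move=> incf.
have -> : [set y in f @: setT | (y < f i)%N] = f @: [set j : 'I_k | (j < i)%N].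
  apply/setP => y; rewrite inE; apply/andP/imsetP => [[/imsetP[j _ ->] lt_f]|].
    exists j => //; rewrite inE ltnNge; apply: contraTN lt_f => le_ij.
    by rewrite -leqNgt increasing_le.
  by move=> [j]; rewrite inE => lt_ji ->; rewrite imset_f ?incf.
rewrite card_imset; last exact: increasing_inj.
have {2}-> : nat_of_ord i = (\sum_(j < i) 1)%N by rewrite sum1_card card_ord.
rewrite -sum1_card.
rewrite (big_ord_widen k (fun=> 1%N) (ltnW (ltn_ord i))).
by apply: eq_bigl => j; rewrite inE.
Qed.

Section Elements.
Context (n k : nat).
Implicit Types (a b : ksubset n k) (i j : 'I_k) (x y : 'I_n).

Lemma elt_in a i : elt a i \in val a.
Proof. exact: enum_valP. Qed.

Lemma eltP a x : x \in val a -> exists i, elt a i = x.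
Proof.
move=> ax; exists (cast_ord (eqP (valP a)) (enum_rank_in ax x)).
by rewrite /elt cast_ordK enum_rankK_in.
Qed.

Lemma elt_inc a : increasing (elt a).
Proof.
move=> i j lt_ij; rewrite /elt.
set i' := cast_ord _ i; set j' := cast_ord _ j.
have x0 : 'I_n := enum_val i'.
rewrite !(enum_val_nth x0).
have sorted_a : sorted (relpre (@nat_of_ord n) ltn) (enum (val a)).
  rewrite /enum_mem sorted_filter //; first by move=> ? ? ?; apply: ltn_trans.
  by rewrite -sorted_map -enumT val_enum_ord iota_ltn_sorted.
have tr : transitive (relpre (@nat_of_ord n) ltn) by move=> ? ? ?; apply: ltn_trans.
have bound (l : 'I_#|val a|) : (l < size (enum (val a)))%N by rewrite -cardE.
exact: (sorted_ltn_nth tr x0 sorted_a i' j' (bound i') (bound j') lt_ij).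
Qed.

Lemma elt_inj a : injective (elt a).
Proof. exact/increasing_inj/elt_inc. Qed.

Lemma elt_le a i j : (i <= j)%N -> (elt a i <= elt a j)%N.
Proof. exact/increasing_le/elt_inc. Qed.

Lemma imset_elt a : elt a @: setT = val a.
Proof.
apply/eqP; rewrite eqEcard; apply/andP; split.
  by apply/subsetP => _ /imsetP[i _ ->]; apply: elt_in.
by rewrite card_imset ?cardsT ?card_ord ?(eqP (valP a)) //; apply: elt_inj.
Qed.

Lemma elt_unique a (f : 'I_k -> 'I_n) : increasing f ->
  (forall i, f i \in val a) -> elt a =1 f.
Proof.
move=> incf fa i.
have im_f : f @: setT = elt a @: setT.
  rewrite imset_elt; apply/eqP; rewrite eqEcard; apply/andP; split.
    by apply/subsetP => _ /imsetP[j _ ->].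
  by rewrite card_imset ?cardsT ?card_ord ?(eqP (valP a)) //; apply: increasing_inj.
have [j eq_j] := eltP (fa i).
have := card_increasing_below i incf; rewrite im_f -eq_j.
by rewrite (card_increasing_below j (@elt_inc a)) => /val_inj->.
Qed.

Lemma ksubset_of_inc (f : 'I_k -> 'I_n) : increasing f ->
  exists2 a : ksubset n k, elt a =1 f & val a = f @: setT.
Proof.
move=> incf; have cf : #|f @: setT| == k.
  by rewrite card_imset ?cardsT ?card_ord //; apply: increasing_inj.
exists (Sub (f @: setT) cf); last by rewrite SubK.
by apply: elt_unique => // i; rewrite SubK imset_f.
Qed.

Lemma eq_elt a b : elt a =1 elt b -> a = b.
Proof.
move=> eq_ab; apply: val_inj; rewrite -!imset_elt.
exact: eq_imset.
Qed.

End Elements.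

Lemma elt_setD1 n k (c : ksubset n k.+1) (a : ksubset n k) (l : 'I_k.+1) :
  val a = val c :\ elt c l -> forall i, elt a i = elt c (lift l i).
Proof.
move=> val_a; apply: elt_unique => [i j lt_ij|i].
  by apply: elt_inc; rewrite /= /bump; do 2!case: leqP => //=; lia.
by rewrite val_a !inE elt_in andbT (inj_eq (@elt_inj _ _ c)) eq_sym neq_lift.
Qed.

(** * The lexicographic and the Plücker order on subsets *)

Section LexOrder.
Context (n m : nat).
Implicit Types (a b c : ksubset n m) (i j : 'I_m).

Lemma expo_sum (V I : finType) (F : I -> V) v :
  expo (\sum_i uvar (F i))%MM v = (\sum_i (F i == v))%N.
Proof.
by rewrite /expo mnm_sumE; apply: eq_bigr => i _; apply: expo_uvar.
Qed.

Lemma expo_diag a i x : expo (diag_mnm a) (i, x) = (elt a i == x).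
Proof.
rewrite expo_sum (bigD1 i) //= big1 ?addn0; first by rewrite xpair_eqE eqxx.
by move=> j ne_ji; rewrite xpair_eqE (negPf ne_ji).
Qed.

(** The order on exponents compares the variables of row i before those of row
    i+1, and x_a contains one variable of each row. *)
Lemma lex_gtP a b : reflect
  (exists2 i, (elt a i < elt b i)%N &
     forall j, (j < i)%N -> elt a j = elt b j)
  (lex_gt a b).
Proof.
apply: (iffP existsP) => [[[i x] /andP[]]|[i lt_i eq_i]].
  rewrite !expo_diag; have [ax|] := eqVneq (elt a i) x; last by case: eqP.
  have [//|bx _ /forallP above] := eqVneq (elt b i) x.
  exists i => [|j lt_ji].
    rewrite ax ltn_neqAle [(_ == _)%N]val_eqE eq_sym bx leqNgt; apply/negP => lt_bx.
    have := above (i, elt b i); rewrite !expo_diag /x_gt /= eqxx lt_bx orbT.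
    by rewrite ax [x == _]eq_sym (negPf bx) eqxx.
  have := above (j, elt a j); rewrite !expo_diag /x_gt /= lt_ji eqxx.
  by case: (elt b j =P elt a j).
exists (i, elt a i); rewrite !expo_diag eqxx -val_eqE /= gtn_eqF //=.
apply/forallP => -[j x]; rewrite !expo_diag /x_gt /=.
apply/implyP => /orP[/eq_i->//|/andP[/eqP-> lt_x]].
by rewrite -!val_eqE /= (gtn_eqF lt_x) (gtn_eqF (ltn_trans lt_x lt_i)).
Qed.

Lemma lex_gt_trans : transitive (@lex_gt n m).
Proof.
move=> b a c /lex_gtP[i lt_i eq_i] /lex_gtP[j lt_j eq_j]; apply/lex_gtP.
case: (ltngtP i j) => [lt_ij|lt_ji|/val_inj eq_ij].
- exists i => [|l lt_l]; first by rewrite -eq_j.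
  by rewrite eq_i ?eq_j // (ltn_trans lt_l).
- exists j => [|l lt_l]; first by rewrite eq_i.
  by rewrite eq_i ?eq_j // (ltn_trans lt_l).
exists i => [|l lt_l]; first by rewrite -eq_ij in lt_j; apply: ltn_trans lt_j.
by rewrite eq_i ?eq_j // -eq_ij.
Qed.

Lemma first_difference a b : a != b ->
  exists2 i, elt a i != elt b i & forall j, (j < i)%N -> elt a j = elt b j.
Proof.
move=> ne_ab; have [i0 ne0] : exists i, elt a i != elt b i.
  apply/existsP; apply: contraNT ne_ab => /existsPn eq_ab.
  by apply/eqP/eq_elt => i; apply/eqP; have := eq_ab i; rewrite negbK.
case: (@arg_minnP _ i0 (fun i => elt a i != elt b i) (@nat_of_ord m) ne0).
move=> i ne_i min_i; exists i => // j lt_ji.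
by apply/eqP; apply: contraTT lt_ji => /min_i; rewrite -leqNgt.
Qed.

Lemma lex_gt_total a b : a != b -> lex_gt a b || lex_gt b a.
Proof.
case/first_difference=> i; rewrite -val_eqE neq_ltn => /orP[] lt_i eq_i.
  by apply/orP; left; apply/lex_gtP; exists i.
by apply/orP; right; apply/lex_gtP; exists i => // j /eq_i.
Qed.

Lemma pluecker_le_not_gt a b : pluecker_le a b -> ~~ lex_gt b a.
Proof.
by move/forallP=> le_ab; apply/lex_gtP => -[i]; rewrite ltnNge le_ab.
Qed.

Lemma lex_gt_comparable a b : lex_gt a b -> comparable a b -> pluecker_le a b.
Proof. by move=> gt_ab /orP[//|/pluecker_le_not_gt]; rewrite gt_ab. Qed.

Lemma x_gt_total (p q : Xidx n m) : p != q -> x_gt p q || x_gt q p.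
Proof.
case: p q => [i x] [j y]; rewrite xpair_eqE /x_gt /= -!val_eqE /=.
by case: (ltngtP i j); case: (ltngtP x y).
Qed.

Lemma x_gt_trans : transitive (@x_gt n m).
Proof.
move=> [j y] [i x] [l z]; rewrite /x_gt /=.
case/orP=> [lt_ij|/andP[/eqP<- lt_xy]].
  by case/orP=> [/(ltn_trans lt_ij)->//|/andP[/eqP<- _]]; rewrite lt_ij.
by case/orP=> [->//|/andP[-> /(ltn_trans lt_xy)->]]; rewrite orbT.
Qed.

Context (D : {set {set 'I_n}}).

Lemma T_gt_total (a b : facet m D) : a != b -> T_gt a b || T_gt b a.
Proof. by rewrite -val_eqE; apply: lex_gt_total. Qed.

Lemma T_gt_trans : transitive (@T_gt n m D).
Proof. by move=> b a c; apply: lex_gt_trans. Qed.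

Lemma XT_gt_total (p q : XTidx m D) : p != q -> XT_gt p q || XT_gt q p.
Proof.
case: p q => [p|a] [q|b] //= ne.
  by apply: x_gt_total; apply: contraNneq ne => ->.
by apply: T_gt_total; apply: contraNneq ne => ->.
Qed.

Lemma XT_gt_trans : transitive (@XT_gt n m D).
Proof.
move=> [q|b] [p|a] [s|c] //=; first exact: x_gt_trans.
exact: T_gt_trans.
Qed.

End LexOrder.

(** * Facets of a unit interval complex *)

(** The columns of the minor indexed by a.  A head symbol of its own keeps the
    nested subtypes behind [val] folded. *)
Definition cols n m (D : {set {set 'I_n}}) (a : facet m D) : ksubset n m := val a.

Lemma cols_inj n m (D : {set {set 'I_n}}) : injective (@cols n m D).
Proof. exact: val_inj. Qed.

Lemma cols_in n m (D : {set {set 'I_n}}) (a : facet m D) : val (cols a) \in D.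
Proof. exact: (valP a). Qed.

Lemma facet_of n m (D : {set {set 'I_n}}) (s : ksubset n m) :
  val s \in D -> exists a : facet m D, cols a = s.
Proof. by move=> sD; exists (Sub s sD); rewrite /cols SubK. Qed.

Section UnitInterval.
Context (m n : nat) (D : {set {set 'I_n}}) (r : nat) (u v : 'I_r.+1 -> 'I_n).
Hypothesis D_complex : simplicial_complex D.
Hypothesis D_unit : unit_interval m D u v.

Lemma interval_maximal k : maximal_clique m D (interval (u k) (v k)).
Proof. by case: D_unit => maxP _ _ _ _; apply/maxP; exists k. Qed.

(** An m-subset that is a face is a clique by itself, and so extends to a maximal
    one. *)
Lemma facetP (a : ksubset n m) :
  val a \in D <-> exists k, val a \subset interval (u k) (v k).
Proof.
split=> [aD | [k sub_ak]].
  have clique_a : (m <= #|val a|)%N && clique m D (val a).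
    rewrite (eqP (valP a)) leqnn; apply/forallP => E.
    apply/implyP => /andP[sub_Ea _]; apply/existsP.
    by exists (val a); rewrite aD.
  have [S max_S sub_aS] :=
    @maxset_exists _ (fun E : {set 'I_n} => (m <= #|E|)%N && clique m D E) _ clique_a.
  case: D_unit => maxP _ _ _ _; have /maxP[k eq_S] : maximal_clique m D S by [].
  by exists k; rewrite -eq_S.
have /maxsetP[/andP[_ /forallP/(_ (val a))]] := interval_maximal k.
rewrite sub_ak (valP a) => /existsP[F /andP[FD sub_aF]] _.
by case: D_complex => _ /(_ F); apply.
Qed.

Lemma u_mono : increasing u.
Proof. by case: D_unit => _ _ + _ _; apply. Qed.

(** Otherwise one maximal clique would contain another one. *)
Lemma v_mono : increasing v.
Proof.
move=> i j lt_ij; rewrite ltnNge; apply/negP => le_v.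
have /maxsetP[_ max_j] := interval_maximal j.
have /maxsetP[clique_i _] := interval_maximal i.
have sub_ji : interval (u j) (v j) \subset interval (u i) (v i).
  apply/subsetP => x; rewrite !inE => /andP[le_ux le_xv].
  by rewrite (leq_trans (ltnW (u_mono lt_ij)) le_ux) (leq_trans le_xv le_v).
have := max_j _ clique_i sub_ji; move/setP/(_ (u i)).
have lt_uv : (u i < v i)%N by case: D_unit => _ + _ _ _; apply.
by rewrite !inE leqnn (ltnW lt_uv) leqNgt u_mono.
Qed.

Lemma sub_intervalP s (a : ksubset n s) (x y : 'I_n) :
  reflect (forall i, (x <= elt a i <= y)%N) (val a \subset interval x y).
Proof.
apply: (iffP subsetP) => [sub i | sub z /eltP[i <-]]; last by rewrite inE.
by have := sub _ (elt_in a i); rewrite inE.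
Qed.

Lemma in_cliqueP (a : facet m D) k :
  reflect (forall i, (u k <= elt (cols a) i <= v k)%N) (in_clique u v a k).
Proof. exact: sub_intervalP. Qed.

Lemma ex_clique (a : facet m D) : exists k, in_clique u v a k.
Proof. by have /facetP := cols_in a. Qed.

Lemma ex_first_clique (a : facet m D) : exists k, first_clique u v a k.
Proof.
have [k0 in_k0] := ex_clique a.
case: (@arg_minnP _ k0 (in_clique u v a) (@nat_of_ord _) in_k0) => k in_k min_k.
by exists k; rewrite /first_clique in_k; apply/forallP => j; apply/implyP/min_k.
Qed.

Lemma facet_of_inc (f : 'I_m -> 'I_n) k : increasing f ->
    (forall i, (u k <= f i <= v k)%N) ->
  exists2 a : facet m D, elt (cols a) =1 f & val (cols a) = [set f i | i : 'I_m].
Proof.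
move=> incf sub_f; have [a elt_a val_a] := ksubset_of_inc incf.
have aD : val a \in D.
  by apply/facetP; exists k; apply/sub_intervalP => i; rewrite elt_a.
have [b eq_b] := facet_of aD; exists b; rewrite eq_b // val_a.
by apply/setP => x; apply/imsetP/imsetP => -[i _ ->]; exists i.
Qed.

Lemma min_ordE (x y : 'I_n) : Order.min x y = minn x y :> nat.
Proof. by rewrite /Order.min ltEord /minn; case: ltnP. Qed.

Lemma max_ordE (x y : 'I_n) : Order.max x y = maxn x y :> nat.
Proof. by rewrite /Order.max ltEord /maxn; case: ltnP. Qed.

(** If the cliques of a and b have indices i <= j then the entrywise minimum lies
    in the clique i and the entrywise maximum in the clique j, because both
    ends of the intervals are increasing. *)
Lemma facet_min_max (a b : facet m D) : exists c d : facet m D,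
  [/\ forall i, elt (cols c) i = minn (elt (cols a) i) (elt (cols b) i) :> nat,
      forall i, elt (cols d) i = maxn (elt (cols a) i) (elt (cols b) i) :> nat,
      val (cols c) = set_min (cols a) (cols b)
    & val (cols d) = set_max (cols a) (cols b)].
Proof.
pose fmin i := Order.min (elt (cols a) i) (elt (cols b) i).
pose fmax i := Order.max (elt (cols a) i) (elt (cols b) i).
have inc_min : increasing fmin.
  move=> i j lt_ij; rewrite !min_ordE.
  by have := elt_inc (cols a) lt_ij; have := elt_inc (cols b) lt_ij; lia.
have inc_max : increasing fmax.
  move=> i j lt_ij; rewrite !max_ordE.
  by have := elt_inc (cols a) lt_ij; have := elt_inc (cols b) lt_ij; lia.
have [k /in_cliqueP ka] := ex_clique a; have [l /in_cliqueP lb] := ex_clique b.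
have [p [q [sub_p sub_q]]] : exists p q,
    (forall i, u p <= fmin i <= v p)%N /\ (forall i, u q <= fmax i <= v q)%N.
  have [le_kl|/ltnW le_lk] := leqP k l.
    have le_u := increasing_le u_mono le_kl; have le_v := increasing_le v_mono le_kl.
    exists k, l; split=> i; rewrite ?min_ordE ?max_ordE.
      by have := ka i; have := lb i; lia.
    by have := ka i; have := lb i; lia.
  have le_u := increasing_le u_mono le_lk; have le_v := increasing_le v_mono le_lk.
  exists l, k; split=> i; rewrite ?min_ordE ?max_ordE.
    by have := ka i; have := lb i; lia.
  by have := ka i; have := lb i; lia.
have [c elt_c val_c] := facet_of_inc inc_min sub_p.
have [d elt_d val_d] := facet_of_inc inc_max sub_q.
exists c, d; split=> // i; first by rewrite elt_c min_ordE.
by rewrite elt_d max_ordE.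
Qed.

(** * Uniqueness of the standard monomial in a fibre *)

Hypothesis m_gt0 : (0 < m)%N.
Local Notation i0 := (Ordinal m_gt0).

Implicit Types (a b c d : facet m D) (A B : 'I_m -> 'I_n -> Prop).

(** [A i x] says that x_ix divides the x-part of a monomial; the two clauses
    say that this part times T_a is divisible by no leading term of the second,
    respectively the first kind of binomials. *)
Definition x_irreducible A a : Prop :=
  (forall i x k, A i x -> (x < elt (cols a) i)%N ->
     (forall j : 'I_m, (j < i)%N -> (elt (cols a) j < x)%N) ->
     (u k <= x)%N -> ~~ in_clique u v a k) /\
  (forall d, (forall i, A i (elt (cols d) i)) -> pluecker_le (cols d) (cols a) ->
     exists2 k, in_clique u v a k & (u k <= elt (cols d) i0)%N).

(** Here [a] and [b] stand for the least facets of two standard monomials of a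
    fibre, and [A], [B] for the supports of their x-parts. *)
Lemma x_irreducible_first_difference A B a b (i : 'I_m) :
    x_irreducible A a -> x_irreducible B b ->
    (forall j, (elt (cols b) j < elt (cols a) j)%N -> A j (elt (cols b) j)) ->
    (forall j, (elt (cols a) j < elt (cols b) j)%N -> B j (elt (cols a) j)) ->
    (forall j : 'I_m, (j < i)%N -> elt (cols a) j = elt (cols b) j) ->
  ~ (elt (cols b) i < elt (cols a) i)%N.
Proof.
set ea := elt (cols a); set eb := elt (cols b).
move=> [no2_a no1_a] [no2_b _] supp_a supp_b eq_below lt_i.
have inc_a : increasing ea by apply: elt_inc.
have inc_b : increasing eb by apply: elt_inc.
have [ka ka_a] := ex_clique a; have [kb kb_b] := ex_clique b.
have /in_cliqueP u_a := ka_a; have /in_cliqueP u_b := kb_b.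
(* In a later row, b_i lies between a_1 and a_i, hence in a clique of a. *)
have i_eq0 : i = i0.
  apply: val_inj; apply/eqP; rewrite /= eqn0Ngt; apply/negP => i_gt0.
  suff : ~~ in_clique u v a ka by rewrite ka_a.
  apply: (no2_a i (eb i) ka (supp_a i lt_i) lt_i).
    by move=> j lt_ji; rewrite -/ea eq_below // inc_b.
  have := u_a i0; rewrite -/ea eq_below // -/eb; have := inc_b i0 i i_gt0; lia.
have lt_0 : (eb i0 < ea i0)%N by rewrite -i_eq0.
(* The first row violating this would insert a_j into b, by b_1 < a_1 <= a_j. *)
have le_ba j : (eb j <= ea j)%N.
  rewrite leqNgt; apply/negP => lt_j.
  case: (@arg_minnP _ j (fun j => ea j < eb j)%N (@nat_of_ord _) lt_j).
  move=> {lt_j}j lt_j min_j.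
  suff : ~~ in_clique u v b kb by rewrite kb_b.
  apply: (no2_b j (ea j) kb (supp_b j lt_j) lt_j).
    move=> l lt_lj; apply: leq_ltn_trans (inc_a l j lt_lj).
    by rewrite leqNgt; apply: contraTN lt_lj => /min_j; rewrite -leqNgt.
  have := u_b i0; rewrite -/eb; have := @increasing_le _ _ ea inc_a i0 j (leq0n _).
  by lia.
have no_eb0 k : (u k <= eb i0)%N -> ~~ in_clique u v a k.
  by apply: no2_a (supp_a _ lt_0) lt_0 _.
(* An equality in row j forces one in row j+1: otherwise b_(j+1) lies strictly
   between a_j = b_j and a_(j+1). *)
have lt_ba j : (eb j < ea j)%N.
  rewrite ltn_neqAle le_ba andbT; apply/negP => eq_j.
  case: (@arg_maxnP _ j (fun j => eb j == ea j :> nat) (@nat_of_ord _) eq_j).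
  move=> {eq_j}j /eqP eq_j max_j.
  have [lt_jm|ge_jm] := ltnP j.+1 m.
    pose j1 := Ordinal lt_jm; have lt_j1 : (eb j1 < ea j1)%N.
      rewrite ltn_neqAle le_ba andbT; apply: contraTneq (ltnSn j) => eq_j1.
      by rewrite -leqNgt; apply: (max_j j1); apply/eqP.
    suff : ~~ in_clique u v a ka by rewrite ka_a.
    apply: (no2_a j1 (eb j1) ka (supp_a _ lt_j1) lt_j1).
      move=> l; rewrite /= ltnS => le_lj; rewrite -/ea.
      have := @increasing_le _ _ ea inc_a l j le_lj.
      by have := inc_b j j1 (ltnSn j); lia.
    have := u_a j; rewrite -/ea -eq_j; have := inc_b j j1 (ltnSn j); lia.
  (* Equality in the last row: the clique of b reaches from b_1 to a_m. *)
  suff in_kb : in_clique u v a kb.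
    by have /andP[/no_eb0] := u_b i0; rewrite in_kb.
  apply/in_cliqueP => l; rewrite -/ea.
  have /(increasing_le inc_a) : (l <= j)%N by have := ltn_ord l; lia.
  have := increasing_le inc_a (leq0n l : i0 <= l)%N.
  by have := u_b j; have := u_b i0; rewrite -/eb; lia.
have le_p : pluecker_le (cols b) (cols a) by apply/forallP.
have [k ka' le_k] := no1_a b (fun j => supp_a j (lt_ba j)) le_p.
by have := no_eb0 k le_k; rewrite ka'.
Qed.

Lemma x_irreducible_eq A B a b :
    x_irreducible A a -> x_irreducible B b ->
    (forall j, (elt (cols b) j < elt (cols a) j)%N -> A j (elt (cols b) j)) ->
    (forall j, (elt (cols a) j < elt (cols b) j)%N -> B j (elt (cols a) j)) ->
  a = b.
Proof.
move=> irr_a irr_b supp_a supp_b; apply/eqP; apply/negP => /negP.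
rewrite -(inj_eq (@cols_inj _ _ _)) => /first_difference[i ne_i eq_i].
have := ne_i; rewrite -val_eqE neq_ltn => /orP[] lt_i.
  by apply: (x_irreducible_first_difference irr_b irr_a supp_b supp_a _ lt_i) => j /eq_i.
exact: (x_irreducible_first_difference irr_a irr_b supp_a supp_b eq_i lt_i).
Qed.

Implicit Types (al be : 'I_m -> 'I_n -> nat) (ta si : facet m D -> nat).

(** The exponent of x_ix in the image of the monomial with exponents [al] in the
    x_ij and [ta] in the T_a. *)
Definition content al ta i x : nat :=
  (al i x + \sum_a ta a * (elt (cols a) i == x))%N.

Definition standard al ta : Prop :=
  (forall a b, (0 < ta a)%N -> (0 < ta b)%N -> comparable (cols a) (cols b)) /\
  (forall a, (0 < ta a)%N -> x_irreducible (fun i x => (0 < al i x)%N) a).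

(** In a chain, the sum of the entries is minimal at the least element only. *)
Lemma chain_min ta : (0 < \sum_a ta a)%N ->
    (forall a b, (0 < ta a)%N -> (0 < ta b)%N -> comparable (cols a) (cols b)) ->
  exists2 a, (0 < ta a)%N & forall b, (0 < ta b)%N -> pluecker_le (cols a) (cols b).
Proof.
move=> sum_gt0 chain.
have [a0 ta0] : exists a, (0 < ta a)%N.
  apply/existsP; apply: contraTT sum_gt0 => /existsPn ta0.
  by rewrite -leqNgt leqn0 sum_nat_eq0; apply/forallP => a; rewrite eqn0Ngt ta0.
pose weight a := (\sum_i elt (cols a) i)%N.
case: (@arg_minnP _ a0 (fun a => 0 < ta a)%N weight ta0) => a ta_a min_a.
exists a => // b ta_b; have /orP[//|/forallP le_ba] := chain a b ta_a ta_b.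
apply/forallP => i; rewrite leqNgt; apply/negP => lt_i.
have := min_a b ta_b; rewrite leqNgt => /negP; apply; rewrite /weight.
rewrite (bigD1 i) //= [X in (_ < X)%N](bigD1 i) //= -addSn.
by apply: leq_add => //; apply: leq_sum => j _; apply: le_ba.
Qed.

(** As [a] is least in its chain, an entry smaller than a_i cannot come from the
    T-part. *)
Lemma content_below al be ta si a b i :
    (forall c, (0 < ta c)%N -> pluecker_le (cols a) (cols c)) -> (0 < si b)%N ->
    content al ta =2 content be si ->
  (elt (cols b) i < elt (cols a) i)%N -> (0 < al i (elt (cols b) i))%N.
Proof.
move=> min_a si_b eq_cont lt_i.
have := eq_cont i (elt (cols b) i); rewrite /content [X in (_ + X)%N]big1.
  rewrite addn0 => ->; rewrite (bigD1 b) //= eqxx muln1; lia.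
move=> c _; have [->//|] := posnP (ta c).
move=> /min_a/forallP/(_ i) le_i.
by rewrite -val_eqE /= gtn_eqF ?muln0 // (leq_trans lt_i).
Qed.

Definition rem1 ta a : facet m D -> nat := fun c => (ta c - (c == a))%N.

Lemma rem1E ta a : (0 < ta a)%N -> forall c, ta c = (rem1 ta a c + (c == a))%N.
Proof. by move=> ta_a c; rewrite /rem1; case: eqP => [->|_]; lia. Qed.

Lemma sum_rem1 ta a (F : facet m D -> nat) : (0 < ta a)%N ->
  (\sum_c ta c * F c = \sum_c rem1 ta a c * F c + F a)%N.
Proof.
move=> ta_a; under eq_bigr => c _ do rewrite (rem1E ta_a) mulnDl.
rewrite big_split /=; congr (_ + _)%N.
rewrite (bigD1 a) //= eqxx mul1n big1 ?addn0 // => c /negPf->.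
by rewrite mul0n.
Qed.

Lemma standard_rem1 al ta a : standard al ta -> standard al (rem1 ta a).
Proof.
move=> [chain irr]; have sub c : (0 < rem1 ta a c -> 0 < ta c)%N.
  by rewrite /rem1; lia.
by split=> [b c /sub tb /sub|b /sub]; [apply: chain | apply: irr].
Qed.

(** The least facets of both monomials agree by [x_irreducible_eq]; cancelling
    this common factor leaves standard monomials of one fibre. *)
Lemma standard_unique al be ta si :
    (\sum_a ta a = \sum_a si a)%N -> content al ta =2 content be si ->
    standard al ta -> standard be si ->
  al =2 be /\ ta =1 si.
Proof.
move Es: (\sum_a ta a)%N => s; elim: s ta si Es => [|s IHs] ta si Es Et eq_cont.
  move=> _ _; have ta0 a : ta a = 0%N.
    by apply/eqP; move/eqP: Es; rewrite sum_nat_eq0 => /forallP/(_ a).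
  have si0 a : si a = 0%N.
    by apply/eqP; move/esym/eqP: Et; rewrite sum_nat_eq0 => /forallP/(_ a).
  split=> [i x|a]; last by rewrite ta0 si0.
  have := eq_cont i x; rewrite /content !big1 ?addn0 // => a _.
    by rewrite si0.
  by rewrite ta0.
move=> std_t std_s; have [chain_t irr_t] := std_t; have [chain_s irr_s] := std_s.
have [|a ta_a min_a] := chain_min (ta := ta) _ chain_t; first by rewrite Es.
have [|b si_b min_b] := chain_min (ta := si) _ chain_s; first by rewrite -Et.
have eq_ab : a = b.
  apply: (x_irreducible_eq (irr_t a ta_a) (irr_s b si_b)) => j.
    exact: content_below eq_cont.
  by apply: (content_below (be := al) min_b ta_a) => i x; rewrite eq_cont.
rewrite -eq_ab in si_b.
have [|||||eq_al eq_ta] := IHs (rem1 ta a) (rem1 si a).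
- have := sum_rem1 (fun=> 1%N) ta_a.
  by under eq_bigr do rewrite muln1; under [in RHS]eq_bigr do rewrite muln1; lia.
- have := sum_rem1 (fun=> 1%N) si_b.
  by under eq_bigr do rewrite muln1; under [in RHS]eq_bigr do rewrite muln1; lia.
- move=> i x; have := eq_cont i x; rewrite /content !(sum_rem1 _ ta_a, sum_rem1 _ si_b).
  lia.
- exact: standard_rem1.
- exact: standard_rem1.
by split=> // c; rewrite (rem1E ta_a) eq_ta -rem1E.
Qed.

End UnitInterval.

(** * Monomial maps and their fibres *)

Section MonomialMaps.
Context (V W : finType) (wx : V -> 'X_{1..#|W|}).
Implicit Types (p q : 'X_{1..#|V|}).

(** Exponent of the image of a monomial under v |-> x^(wx v). *)
Definition weight p : 'X_{1..#|W|} := (\sum_k wx (enum_val k) *+ p k)%MM.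

Lemma weightD p q : weight (p + q)%MM = (weight p + weight q)%MM.
Proof.
rewrite -big_split /=; apply: eq_bigr => k _; apply/mnmP => i.
by rewrite mnmDE !mulmnE mnmDE mulnDr.
Qed.

Lemma weight_uvar v : weight (uvar v) = wx v.
Proof.
rewrite /weight (bigD1 (enum_rank v)) //= enum_rankK mnm1E eqxx big1.
  by rewrite addm0; apply/mnmP => i; rewrite mulmnE muln1.
move=> k ne_k; rewrite mnm1E eq_sym (negPf ne_k).
by apply/mnmP => i; rewrite mulmnE muln0.
Qed.

Lemma weight0 : weight 0%MM = 0%MM.
Proof.
rewrite /weight big1 // => k _; apply/mnmP => i.
by rewrite mulmnE !mnm0E muln0.
Qed.

Lemma weight_sum (I : finType) (F : I -> 'X_{1..#|V|}) :
  weight (\sum_i F i)%MM = (\sum_i weight (F i))%MM.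
Proof. exact: (big_morph weight weightD weight0). Qed.

Lemma expo_weight p w : expo (weight p) w = (\sum_v expo (wx v) w * expo p v)%N.
Proof.
rewrite /expo mnm_sumE (reindex _ (onW_bij _ (@enum_rank_bij V))) /=.
by apply: eq_bigr => v _; rewrite enum_rankK mulmnE.
Qed.

Lemma mmap1_weight (A : comNzRingType) (mon : 'X_{1..#|W|} -> A) (h : V -> A) p :
    mon 0%MM = 1 -> {morph mon : x y / (x + y)%MM >-> x * y} ->
    (forall v, h v = mon (wx v)) ->
  mmap1 (fun k => h (enum_val k)) p = mon (weight p).
Proof.
move=> mon0 monD hE; rewrite /weight (big_morph mon monD mon0) /mmap1.
apply: eq_bigr => k _; rewrite hE; elim: (p k) => [|d IHd].
  by rewrite expr0 mulm0n mon0.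
by rewrite exprS IHd mulmS monD.
Qed.

End MonomialMaps.

(** Each coefficient of the image of f is the sum of the coefficients of f over one
    fibre, so no fibre can contain exactly one term of a kernel element. *)
Lemma kernel_support (N : nat) (K : fieldType) (A : comNzRingType)
    (c : K -> A) (h : 'I_N -> A) (T : eqType) (pi : 'X_{1..N} -> T)
    (coef : T -> A -> K) (f : {mpoly K[N]}) p :
    (forall t, coef t 0 = 0) -> (forall t, {morph coef t : x y / x + y}) ->
    (forall t k q, coef t (c k * mmap1 h q) = k *+ (pi q == t)) ->
    mmap c h f = 0 -> p \in msupp f ->
  exists q, [/\ q \in msupp f, q != p & pi q = pi p].
Proof.
move=> coef0 coefD coefE f0 fp.
have [/hasP[q fq /andP[ne_qp /eqP pi_qp]]|] :=
  boolP (has (fun q => (q != p) && (pi q == pi p)) (msupp f)).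
  by exists q.
move=> /hasPn no_q; have := congr1 (coef (pi p)) f0.
rewrite coef0 /mmap (big_morph _ (coefD (pi p)) (coef0 (pi p))).
rewrite (bigD1_seq p) //= coefE eqxx mulr1n big_seq_cond big1 ?addr0.
  by move/eqP; rewrite (negPf (_ : f@_p != 0)) // -mcoeff_msupp.
move=> q /andP[/no_q + ne_qp]; rewrite ne_qp /= => /negPf ne_pi.
by rewrite coefE ne_pi mulr0n.
Qed.

(** * The two presentation ideals as toric ideals *)

Section Presentations.
Context (K : fieldType) (m n : nat) (D : {set {set 'I_n}}).
Local Notation RT := (RT K m D).
Local Notation KT := (KT K m D).
Implicit Types (a b c d : facet m D).

Definition phi_weight (w : XTidx m D) : 'X_{1..#|Xidx n m|} :=
  match w with inl ix => uvar ix | inr a => diag_mnm (cols a) end.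

Definition psi_weight a : 'X_{1..#|Xidx n m|} := diag_mnm (cols a).

Definition Tdeg (p : 'X_{1..#|XTidx m D|}) : nat := (\sum_a expo p (inr a))%N.

(** [Tdeg] records the exponent of t. *)
Definition phi_fibre p := (weight phi_weight p, Tdeg p).
Definition psi_fibre p := weight psi_weight p.

Definition x_part (p : 'X_{1..#|XTidx m D|}) (i : 'I_m) (x : 'I_n) : nat :=
  expo p (inl (i, x)).
Definition T_part (p : 'X_{1..#|XTidx m D|}) a : nat := expo p (inr a).

Lemma expo_phi_fibre p i x :
  expo (phi_fibre p).1 (i, x) = content (x_part p) (T_part p) i x.
Proof.
rewrite expo_weight big_sumType /content /=; congr (_ + _)%N.
  rewrite (bigD1 (i, x)) //= expo_uvar eqxx mul1n big1 ?addn0 // => jy ne.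
  by rewrite expo_uvar (negPf ne).
by apply: eq_bigr => a _; rewrite expo_diag mulnC.
Qed.

Lemma expo_psi_fibre p i x :
  expo (psi_fibre p) (i, x) = content (fun _ _ => 0%N) (expo p) i x.
Proof.
rewrite expo_weight /content add0n.
by apply: eq_bigr => a _; rewrite expo_diag mulnC.
Qed.

Lemma phi_fibre_add s p q :
  phi_fibre p = phi_fibre q -> phi_fibre (p + s)%MM = phi_fibre (q + s)%MM.
Proof.
rewrite /phi_fibre !weightD => -[-> eq_deg]; congr (_, _).
rewrite /Tdeg; under eq_bigr do rewrite expoD.
under [RHS]eq_bigr do rewrite expoD.
by rewrite !big_split /= -/(Tdeg p) eq_deg.
Qed.

Lemma psi_fibre_add s p q :
  psi_fibre p = psi_fibre q -> psi_fibre (p + s)%MM = psi_fibre (q + s)%MM.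
Proof. by rewrite /psi_fibre !weightD => ->. Qed.

Let phi_h (k : 'I_#|XTidx m D|) : {poly R K m n} :=
  match enum_val k with
  | inl ij => (x_ K ij.1 ij.2)%:P
  | inr a => (xmon K (cols a))%:P * 'X
  end.

Lemma phi_mmap1 p : mmap1 phi_h p = ('X_[(phi_fibre p).1])%:P * 'X^((phi_fibre p).2).
Proof.
pose h1 (w : XTidx m D) : {poly R K m n} := ('X_[K, phi_weight w])%:P.
pose h2 (w : XTidx m D) : {poly R K m n} := if w is inr a then 'X else 1.
rewrite -(@mmap1_weight _ _ phi_weight _ (fun q => ('X_[K, q])%:P) h1 p); first last.
- by [].
- by move=> q s; rewrite mpolyXD polyCM.
- by rewrite mpolyX0.
have -> : 'X^((phi_fibre p).2) = mmap1 (fun k => h2 (enum_val k)) p.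
  rewrite /phi_fibre /Tdeg /mmap1 (reindex _ (onW_bij _ (@enum_rank_bij _))) /=.
  rewrite big_sumType /= [X in X * _]big1 ?mul1r => [|ix _].
    rewrite (big_morph _ (exprD 'X) (expr0 'X)).
    by apply: eq_bigr => a _; rewrite enum_rankK.
  by rewrite enum_rankK expr1n.
rewrite /mmap1 -big_split /=; apply: eq_bigr => k _; rewrite -exprMn.
congr (_ ^+ _); rewrite /phi_h /h1 /h2; case: (enum_val k) => [[i x]|a] //=.
by rewrite mulr1.
Qed.

Lemma phiX p : phi ('X_[K, p] : RT) = ('X_[(phi_fibre p).1])%:P * 'X^((phi_fibre p).2).
Proof. by rewrite -phi_mmap1; apply: mmapX. Qed.

Lemma phiD (f g : RT) : phi (f + g) = phi f + phi g.
Proof. exact: rmorphD. Qed.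

Lemma phiM (f g : RT) : phi (f * g) = phi f * phi g.
Proof. exact: rmorphM. Qed.

Lemma phi_support (f : RT) p : ker_phi f -> p \in msupp f ->
  exists q, [/\ q \in msupp f, q != p & phi_fibre q = phi_fibre p].
Proof.
apply: (kernel_support (coef := fun t (g : {poly R K m n}) => (g`_t.2)@_t.1)).
- by move=> t; rewrite coef0 mcoeff0.
- by move=> t x y; rewrite coefD mcoeffD.
move=> t k q; rewrite phi_mmap1 mulrA -polyCM coefMXn coefC.
have -> : (phi_fibre q == t) = ((phi_fibre q).1 == t.1) && ((phi_fibre q).2 == t.2).
  by case: t => t1 t2; rewrite -pair_eqE.
case: ltngtP => [lt_t|gt_t|eq_t]; rewrite ?andbF ?mulr0n ?mcoeff0 //.
  by rewrite subn_eq0 leqNgt gt_t mcoeff0.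
by rewrite eq_t subnn eqxx mcoeffCM mcoeffX andbT mulr_natr.
Qed.

Lemma phi_kernel_fibre p q : phi_fibre p = phi_fibre q ->
  ker_phi ('X_[p] - 'X_[q] : RT).
Proof.
move=> eq_pq; rewrite /ker_phi (_ : phi _ = phi 'X_[p] - phi 'X_[q]).
  by rewrite !phiX eq_pq subrr.
exact: rmorphB.
Qed.

Lemma psiX p : psi ('X_[K, p] : KT) = 'X_[psi_fibre p].
Proof.
rewrite /psi /subst mmapX.
apply: (@mmap1_weight _ _ psi_weight _ (fun q => 'X_[K, q]) (fun a => xmon K (cols a))).
- exact: mpolyX0.
- exact: mpolyXD.
- by [].
Qed.

Lemma psi_support (f : KT) p : ker_psi f -> p \in msupp f ->
  exists q, [/\ q \in msupp f, q != p & psi_fibre q = psi_fibre p].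
Proof.
apply: (kernel_support (coef := fun t (g : R K m n) => g@_t)).
- by move=> t; rewrite mcoeff0.
- by move=> t x y; rewrite mcoeffD.
move=> t k q.
have -> : mmap1 (fun l => xmon K (val (enum_val l : facet m D))) q = 'X_[psi_fibre q].
  by rewrite -psiX /psi /subst mmapX.
by rewrite mcoeffCM mcoeffX mulr_natr.
Qed.

Lemma psi_kernel_fibre p q : psi_fibre p = psi_fibre q ->
  ker_psi ('X_[p] - 'X_[q] : KT).
Proof.
move=> eq_pq; rewrite /ker_psi (_ : psi _ = psi 'X_[p] - psi 'X_[q]).
  by rewrite !psiX eq_pq subrr.
exact: rmorphB.
Qed.

Lemma mpolyX_sum (N : nat) (I : finType) (F : I -> 'X_{1..N}) :
  'X_[K, \sum_i F i] = \prod_i 'X_[F i].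
Proof. exact: (big_morph _ (@mpolyXD N K) (mpolyX0 N K)). Qed.

(** Exponent of x_a inside R[T]. *)
Definition diagT (s : ksubset n m) : 'X_{1..#|XTidx m D|} :=
  (\sum_(i < m) uvar (inl (i, elt s i)))%MM.

Lemma xRT_X (i : 'I_m) (x : 'I_n) : xRT K D i x = 'X_[uvar (inl (i, x))].
Proof. by rewrite /xRT /R_in_RT /incl /subst mmapX mmap1U enum_rankK. Qed.

Lemma TRT_X a : TRT K a = 'X_[uvar (inr a)].
Proof. by rewrite /TRT /KT_in_RT /incl /subst mmapX mmap1U enum_rankK. Qed.

Lemma R_in_RT_xmon s : R_in_RT D (xmon K s) = 'X_[diagT s] :> RT.
Proof.
rewrite /xmon /diag_mnm /diagT !mpolyX_sum.
rewrite /R_in_RT /incl /subst rmorph_prod; apply: eq_bigr => i _.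
by rewrite /= mmapX mmap1U enum_rankK.
Qed.

Lemma weight_diagT s : weight phi_weight (diagT s) = diag_mnm s.
Proof. by rewrite weight_sum; apply: eq_bigr => i _; rewrite weight_uvar. Qed.

Lemma expo_diagT_x s (i : 'I_m) (x : 'I_n) : expo (diagT s) (inl (i, x)) = (elt s i == x).
Proof.
rewrite expo_sum (bigD1 i) //= big1 ?addn0 => [|j ne_ji].
  by rewrite (inj_eq inl_inj) xpair_eqE eqxx.
by rewrite (inj_eq inl_inj) xpair_eqE (negPf ne_ji).
Qed.

Lemma expo_diagT_T s a : expo (diagT s) (inr a) = 0%N.
Proof. by rewrite expo_sum big1. Qed.

End Presentations.

(** * The three families of binomials *)

Section Binomials.
Context (K : fieldType) (m n : nat) (D : {set {set 'I_n}}).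
Context (r : nat) (u v : 'I_r.+1 -> 'I_n).
Hypothesis m_gt0 : (0 < m)%N.
Hypothesis D_complex : simplicial_complex D.
Hypothesis D_unit : unit_interval m D u v.
Local Notation RT := (RT K m D).
Local Notation KT := (KT K m D).
Local Notation i0 := (Ordinal m_gt0).
Implicit Types (a b c d : facet m D).

Definition xv (i : 'I_m) (x : 'I_n) : 'X_{1..#|XTidx m D|} := uvar (inl (i, x)).
Definition Tv a : 'X_{1..#|XTidx m D|} := uvar (inr a).

Lemma expo_xv_x (i : 'I_m) (x : 'I_n) jy :
  expo (xv i x) (inl jy) = ((i, x) == jy).
Proof. by rewrite expo_uvar (inj_eq inl_inj). Qed.

Lemma expo_Tv_T a b : expo (Tv a) (inr b) = (a == b).
Proof. by rewrite expo_uvar (inj_eq inr_inj). Qed.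

Lemma expo_xv_T (i : 'I_m) (x : 'I_n) a : expo (xv i x) (inr a) = 0%N.
Proof. by rewrite expo_uvar. Qed.

Lemma expo_Tv_x a ix : expo (Tv a) (inl ix) = 0%N.
Proof. by rewrite expo_uvar. Qed.

Definition expoE := (expoD, expo_xv_x, expo_Tv_T, expo_xv_T, expo_Tv_x,
  expo_diagT_x, expo_diagT_T).

Lemma mdeg_diagT (s : ksubset n m) : mdeg (diagT D s) = m.
Proof.
rewrite mdeg_sum; under eq_bigr do rewrite mdeg1.
by rewrite sum_nat_const card_ord muln1.
Qed.

Lemma TdegD (p q : 'X_{1..#|XTidx m D|}) : Tdeg (p + q)%MM = (Tdeg p + Tdeg q)%N.
Proof. by rewrite -big_split; apply: eq_bigr => a _; rewrite /= expoD. Qed.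

Lemma Tdeg_Tv a : Tdeg (Tv a) = 1%N.
Proof.
rewrite /Tdeg (bigD1 a) //= expo_Tv_T eqxx big1 // => b ne_ba.
by rewrite expo_Tv_T eq_sym (negPf ne_ba).
Qed.

Lemma Tdeg_xv (i : 'I_m) (x : 'I_n) : Tdeg (xv i x : 'X_{1..#|XTidx m D|}) = 0%N.
Proof. by rewrite /Tdeg big1 // => a _; rewrite expo_xv_T. Qed.

Lemma Tdeg_diagT (s : ksubset n m) : Tdeg (diagT D s) = 0%N.
Proof. by rewrite /Tdeg big1 // => a _; rewrite expo_diagT_T. Qed.

(** If a precedes b in both orders, the last row where they differ shows that
    x_b contains the smaller variable. *)
Lemma lead_binom1 a b : lex_gt (cols a) (cols b) -> comparable (cols a) (cols b) ->
  XT_lt (diagT D (cols b) + Tv a)%MM (diagT D (cols a) + Tv b)%MM.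
Proof.
move=> gt_ab cmp_ab; have /forallP le_ab := lex_gt_comparable gt_ab cmp_ab.
have /lex_gtP[j lt_j _] := gt_ab.
case: (@arg_maxnP _ j (fun j => elt (cols a) j < elt (cols b) j)%N (@nat_of_ord _) lt_j).
move=> {lt_j}i lt_i max_i.
apply: (@degrevlexI _ _ (inl (i, elt (cols b) i))).
- by rewrite !mdegD !mdeg_diagT !mdeg1.
- by rewrite !expoE eqxx -val_eqE /= ltn_eqF.
move=> [[l y]|] //=; rewrite !expoE /x_gt /= => /orP[lt_il|/andP[/eqP<- lt_y]].
  suff -> : elt (cols a) l = elt (cols b) l by [].
  apply/val_inj/eqP; rewrite /= eqn_leq le_ab leqNgt.
  by apply: contraL lt_il => /max_i; rewrite -leqNgt.
by rewrite -!val_eqE /= (ltn_eqF lt_y) (ltn_eqF (ltn_trans lt_i lt_y)).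
Qed.

Lemma binom1E (f : RT) : binom1 u v f ->
  exists a b, [/\ lex_gt (cols a) (cols b), comparable (cols a) (cols b)
    & f = R_in_RT D (xmon K (cols a)) * TRT K b - R_in_RT D (xmon K (cols b)) * TRT K a].
Proof.
intros [a H]; destruct H as [b [ia [ib [_ _ gt_ab cmp_ab ef]]]].
by exists a, b.
Qed.

Lemma binom1_fibre (f : RT) :
  binom1 u v f -> fibre_binomial (@XT_lt n m D) (@phi_fibre m n D) f.
Proof.
move=> /binom1E[a [b [gt_ab cmp_ab ->]]].
exists (diagT D (cols a) + Tv b)%MM, (diagT D (cols b) + Tv a)%MM; split.
- exact: lead_binom1.
- rewrite /phi_fibre !weightD !weight_diagT !weight_uvar addmC; congr (_, _).
  by rewrite !TdegD !Tdeg_diagT !Tdeg_Tv.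
by rewrite !R_in_RT_xmon !TRT_X !mpolyXD.
Qed.

Lemma lift_widen_neq (i j : 'I_m) : j != i ->
  lift (widen_ord (leqnSn m) i) j = lift (lift ord0 i) j.
Proof.
rewrite -val_eqE => ne_ji; apply: val_inj; rewrite /= /bump /=.
by move: ne_ji; case: ltngtP => //=; lia.
Qed.

Lemma lift_widen_eq (i : 'I_m) :
  lift (widen_ord (leqnSn m) i) i = lift ord0 i.
Proof. by apply: val_inj; rewrite /= /bump /= leqnn. Qed.

Lemma lift_lift_eq (i : 'I_m) :
  lift (lift ord0 i) i = widen_ord (leqnSn m) i.
Proof. by apply: val_inj; rewrite /= /bump /= ltnn. Qed.

(** Deleting c_i or c_(i+1) from c gives sequences that differ in the row i only,
    where they have c_(i+1) and c_i respectively. *)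
Lemma exchange_fibre (c : ksubset n m.+1) (i : 'I_m) (p q : facet m D) :
    let ci := elt c (widen_ord (leqnSn m) i) in
    let ci1 := elt c (lift ord0 i) in
    val (cols p) = val c :\ ci -> val (cols q) = val c :\ ci1 ->
  phi_fibre (xv i ci1 + Tv q)%MM = phi_fibre (xv i ci + Tv p)%MM.
Proof.
move=> ci ci1 /elt_setD1 elt_p /elt_setD1 elt_q.
rewrite /phi_fibre !TdegD !Tdeg_xv !Tdeg_Tv !weightD !weight_uvar /=; congr (_, _).
apply: expoP => -[j x]; rewrite !expoD !expo_uvar !expo_diag elt_p elt_q.
rewrite !xpair_eqE [i == j]eq_sym; have [->|ne_ji] := eqVneq j i.
  by rewrite lift_widen_eq lift_lift_eq addnC.
by rewrite lift_widen_neq.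
Qed.

(** The smallest variable involved is x_iy. *)
Lemma lead_exchange (i : 'I_m) (x y : 'I_n) a b : (x < y)%N ->
  XT_lt (xv i y + Tv b)%MM (xv i x + Tv a)%MM.
Proof.
move=> lt_xy; apply: (@degrevlexI _ _ (inl (i, y))).
- by rewrite !mdegD !mdeg1.
- by rewrite !expoE eqxx xpair_eqE -[x == y]val_eqE /= ltn_eqF ?andbF.
move=> [[l z]|] //=; rewrite !expoE /x_gt /= !xpair_eqE -!val_eqE /=.
move=> /orP[lt_il|/andP[_ lt_yz]]; first by rewrite ltn_eqF.
by rewrite (ltn_eqF lt_yz) (ltn_eqF (ltn_trans lt_xy lt_yz)).
Qed.

Lemma binom2E (f : RT) : binom2 u v f ->
  exists (c : ksubset n m.+1) (i : 'I_m) (p q : facet m D),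
    let ci := elt c (widen_ord (leqnSn m) i) in
    let ci1 := elt c (lift ord0 i) in
    [/\ val (cols p) = val c :\ ci, val (cols q) = val c :\ ci1
      & f = xRT K D i ci * TRT K p - xRT K D i ci1 * TRT K q].
Proof.
intros [c H]; destruct H as [i [p [q [_ val_p val_q ef]]]].
by exists c, i, p, q.
Qed.

Lemma binom2_fibre (f : RT) :
  binom2 u v f -> fibre_binomial (@XT_lt n m D) (@phi_fibre m n D) f.
Proof.
move=> /binom2E[c [i [p [q [val_p val_q ->]]]]].
exists (xv i (elt c (widen_ord (leqnSn m) i)) + Tv p)%MM.
exists (xv i (elt c (lift ord0 i)) + Tv q)%MM; split.
- by apply: lead_exchange; apply: elt_inc; rewrite /= /bump.
- exact: exchange_fibre.
by rewrite !xRT_X !TRT_X !mpolyXD.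
Qed.

Section MinMax.
Context (a b c d : facet m D).
Hypothesis incomp : ~~ comparable (cols a) (cols b).
Hypothesis val_c : val (cols c) = set_min (cols a) (cols b).
Hypothesis val_d : val (cols d) = set_max (cols a) (cols b).

Lemma elt_min_max i :
  elt (cols c) i = minn (elt (cols a) i) (elt (cols b) i) :> nat /\
  elt (cols d) i = maxn (elt (cols a) i) (elt (cols b) i) :> nat.
Proof.
have [c' [d' [elt_c elt_d val_c' val_d']]] := facet_min_max D_complex D_unit a b.
have -> : c = c' by apply/cols_inj/val_inj; rewrite val_c.
by have -> : d = d' by apply/cols_inj/val_inj; rewrite val_d.
Qed.

Lemma pluecker_max : [/\ pluecker_le (cols a) (cols d), pluecker_le (cols b) (cols d)
  & pluecker_le (cols c) (cols d)].
Proof.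
split; apply/forallP => i; have [ec ed] := elt_min_max i.
- by rewrite ed leq_maxl.
- by rewrite ed leq_maxr.
by rewrite ec ed geq_min leq_maxl.
Qed.

Lemma max_new : a != d /\ b != d.
Proof.
have [le_ad le_bd _] := pluecker_max; move: incomp; rewrite /comparable.
by split; apply: contraNneq incomp => eq_d; rewrite /comparable eq_d ?le_ad ?le_bd ?orbT.
Qed.

Lemma below_max w : T_gt d w -> [&& w != a, w != b, w != c & w != d].
Proof.
move=> gt_dw; have [le_ad le_bd le_cd] := pluecker_max.
have le_dd : pluecker_le (cols d) (cols d) by apply/forallP => i; apply: leqnn.
have ne x : pluecker_le (cols x) (cols d) -> w != x.
  move=> le_xd; apply/eqP => eq_wx; rewrite /T_gt eq_wx in gt_dw.
  by have /negP := pluecker_le_not_gt le_xd; apply.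
by apply/and4P; split; apply: ne.
Qed.

(** In every row, minimum and maximum are the two given entries. *)
Lemma diag_min_max :
  (diag_mnm (cols c) + diag_mnm (cols d) = diag_mnm (cols a) + diag_mnm (cols b))%MM.
Proof.
apply: expoP => -[i x]; rewrite !expoD !expo_diag -!val_eqE /=.
have [-> ->] := elt_min_max i; rewrite /minn /maxn.
by case: ltnP => // _; rewrite addnC.
Qed.

Lemma lead_min_max : XT_lt (Tv c + Tv d)%MM (Tv a + Tv b)%MM.
Proof.
have [ne_ad ne_bd] := max_new.
apply: degrevlex_exchange; rewrite ?(inj_eq inr_inj) // => -[//|w].
by rewrite /= !(inj_eq inr_inj); apply: below_max.
Qed.

Lemma min_max_fibre : phi_fibre (Tv c + Tv d)%MM = phi_fibre (Tv a + Tv b)%MM.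
Proof.
by rewrite /phi_fibre !weightD !weight_uvar !TdegD !Tdeg_Tv /= diag_min_max.
Qed.

Lemma psi_lead_min_max : T_lt (uvar c + uvar d)%MM (uvar a + uvar b)%MM.
Proof.
have [ne_ad ne_bd] := max_new.
by apply: degrevlex_exchange => // w; apply: below_max.
Qed.

Lemma psi_min_max_fibre :
  psi_fibre (uvar c + uvar d)%MM = psi_fibre (uvar a + uvar b)%MM.
Proof. by rewrite /psi_fibre !weightD !weight_uvar; apply: diag_min_max. Qed.

End MinMax.

Lemma binom3E (S : nzRingType) (T : facet m D -> S) (f : S) : binom3 T f <->
  exists a b c d : facet m D,
    [/\ ~~ comparable (cols a) (cols b), val (cols c) = set_min (cols a) (cols b),
        val (cols d) = set_max (cols a) (cols b) & f = T a * T b - T c * T d].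
Proof. by []. Qed.

Lemma binom3_phi_fibre (f : RT) :
  binom3 (@TRT K m n D) f -> fibre_binomial (@XT_lt n m D) (@phi_fibre m n D) f.
Proof.
move=> /binom3E[a [b [c [d [incomp val_c val_d ->]]]]].
exists (Tv a + Tv b)%MM, (Tv c + Tv d)%MM; split.
- exact: lead_min_max.
- exact: min_max_fibre.
by rewrite !TRT_X !mpolyXD.
Qed.

Lemma binom3_psi_fibre (f : KT) :
  binom3 (@T_ K m n D) f -> fibre_binomial (@T_lt n m D) (@psi_fibre m n D) f.
Proof.
move=> /binom3E[a [b [c [d [incomp val_c val_d ->]]]]].
exists (uvar a + uvar b)%MM, (uvar c + uvar d)%MM; split.
- exact: psi_lead_min_max.
- exact: psi_min_max_fibre.
by rewrite !mpolyXD.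
Qed.

Lemma G_fibre (f : RT) :
  G u v f -> fibre_binomial (@XT_lt n m D) (@phi_fibre m n D) f.
Proof.
by case; [apply: binom1_fibre | apply: binom2_fibre | apply: binom3_phi_fibre].
Qed.

(** * Reducibility of the non-standard monomials *)

Lemma uvarD_le (V : finType) (x y : V) (p : 'X_{1..#|V|}) : x != y ->
  (0 < expo p x)%N -> (0 < expo p y)%N -> (uvar x + uvar y <= p)%MM.
Proof.
move=> ne_xy px py; apply: expo_lepP => z; rewrite expoD !expo_uvar.
have [<-|_] := eqVneq x z; first by rewrite eq_sym (negPf ne_xy) addn0.
by have [<-|_] := eqVneq y z.
Qed.

Lemma incomparable_neq a b : ~~ comparable (cols a) (cols b) -> a != b.
Proof.
apply: contraNneq => ->; apply/orP; left.
by apply/forallP.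
Qed.

Lemma incomparable_reducible p a b : (0 < expo p (inr a))%N ->
    (0 < expo p (inr b))%N -> ~~ comparable (cols a) (cols b) ->
  reducible (@XT_lt n m D) (@phi_fibre m n D) (@G K m n D r u v) p.
Proof.
move=> pa pb incomp; have [c [d [_ _ val_c val_d]]] := facet_min_max D_complex D_unit a b.
have B3 : binom3 (@TRT K m n D) ('X_[Tv a + Tv b] - 'X_[Tv c + Tv d]).
  by apply/binom3E; exists a, b, c, d; split=> //; rewrite !TRT_X !mpolyXD.
exists (Tv a + Tv b)%MM, (Tv c + Tv d)%MM; split.
- exact: lead_min_max.
- exact: min_max_fibre.
- by apply: Or33.
by apply: uvarD_le => //; rewrite (inj_eq inr_inj) incomparable_neq.
Qed.

Lemma psi_incomparable_reducible p a b : (0 < expo p a)%N ->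
    (0 < expo p b)%N -> ~~ comparable (cols a) (cols b) ->
  reducible (@T_lt n m D) (@psi_fibre m n D) (@G' K m n D) p.
Proof.
move=> pa pb incomp; have [c [d [_ _ val_c val_d]]] := facet_min_max D_complex D_unit a b.
exists (uvar a + uvar b)%MM, (uvar c + uvar d)%MM; split.
- exact: psi_lead_min_max.
- exact: psi_min_max_fibre.
- by apply/binom3E; exists a, b, c, d; split=> //; rewrite !mpolyXD.
by apply: uvarD_le => //; apply: incomparable_neq.
Qed.

(** The faces of the clique complex may be larger than those of D, but their
    m-subsets are facets. *)
Lemma facet_setD1 (c : ksubset n m.+1) k (l : 'I_m.+1) :
  val c \subset Defs.interval (u k) (v k) ->
  exists a : facet m D, val (cols a) = val c :\ elt c l.
Proof.
move=> sub_c; have card_a : #|val c :\ elt c l| == m.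
  by have := cardsD1 (elt c l) (val c); rewrite elt_in (eqP (valP c)) add1n => -[eq_m]; rewrite eq_sym; apply/eqP.
pose a : ksubset n m := Sub (val c :\ elt c l) card_a.
have aD : val a \in D.
  apply/(facetP D_complex D_unit); exists k; rewrite SubK.
  exact: subset_trans (subD1set _ _) sub_c.
by have [b eq_b] := facet_of aD; exists b; rewrite eq_b SubK.
Qed.

(** Inserting x just below a_i turns the facet a into an m-dimensional face of the
    clique complex, from which a is recovered by deleting x. *)
Lemma insertion a (i : 'I_m) (x : 'I_n) k :
    (x < elt (cols a) i)%N ->
    (forall j : 'I_m, (j < i)%N -> (elt (cols a) j < x)%N) ->
    (u k <= x)%N -> in_clique u v a k ->
  exists c : ksubset n m.+1, [/\ val c \subset Defs.interval (u k) (v k),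
    elt c (widen_ord (leqnSn m) i) = x
    & forall j, elt c (lift (widen_ord (leqnSn m) i) j) = elt (cols a) j].
Proof.
set h := widen_ord _ i; move=> lt_x above le_x /in_cliqueP in_a.
pose f (l : 'I_m.+1) := if unlift h l is Some j then elt (cols a) j else x.
have fh : f h = x by rewrite /f unlift_none.
have fl j : f (lift h j) = elt (cols a) j by rewrite /f liftK.
have inc_f : increasing f.
  move=> l l'; case: (unliftP h l) => [j|] ->; case: (unliftP h l') => [j'|] ->.
  - rewrite !fl => lt_l; apply: elt_inc; move: lt_l; rewrite /= /bump.
    by do 2!case: leqP => /=; lia.
  - rewrite fl fh /= /bump => lt_l; apply: above; move: lt_l.
    by case: leqP => /=; lia.
  - rewrite fl fh /= /bump => lt_l; apply: leq_trans lt_x _; apply: elt_le.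
    by move: lt_l; case: leqP => /=; lia.
  by rewrite ltnn.
have [c elt_c val_c] := ksubset_of_inc inc_f.
exists c; split; [|by rewrite elt_c | by move=> j; rewrite elt_c].
apply/sub_intervalP => l; rewrite elt_c.
case: (unliftP h l) => [j|] ->; first by rewrite fl in_a.
by rewrite fh le_x (leq_trans (ltnW lt_x)) //; have /andP[] := in_a i.
Qed.

Lemma insertion_reducible p a (i : 'I_m) (x : 'I_n) k :
    (0 < expo p (inl (i, x)))%N -> (0 < expo p (inr a))%N ->
    (x < elt (cols a) i)%N ->
    (forall j : 'I_m, (j < i)%N -> (elt (cols a) j < x)%N) ->
    (u k <= x)%N -> in_clique u v a k ->
  reducible (@XT_lt n m D) (@phi_fibre m n D) (@G K m n D r u v) p.
Proof.
move=> px pa lt_x above le_x in_a.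
have [c [sub_c elt_x elt_c]] := insertion lt_x above le_x in_a.
have [a' val_a'] := facet_setD1 (widen_ord (leqnSn m) i) sub_c.
have [b val_b] := facet_setD1 (lift ord0 i) sub_c.
have eq_a : a' = a.
  by apply/cols_inj/eq_elt => j; rewrite (elt_setD1 val_a') elt_c.
rewrite {a'}eq_a in val_a'.
pose y := elt c (lift ord0 i).
exists (xv i x + Tv a)%MM, (xv i y + Tv b)%MM; split.
- by apply: lead_exchange; rewrite /y -elt_x; apply: elt_inc; rewrite /= /bump.
- by rewrite (exchange_fibre val_a' val_b) elt_x.
- apply: Or32; exists c, i, a, b; split=> //; first by apply/existsP; exists k.
  by rewrite !xRT_X !TRT_X !mpolyXD elt_x.
exact: uvarD_le.
Qed.

(** If no clique of a reaches down to the first element of d, then d misses the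
    first clique of a and lies in an earlier one. *)
Lemma binom1_reducible p a d :
    (forall i : 'I_m, 0 < expo p (inl (i, elt (cols d) i)))%N -> (0 < expo p (inr a))%N ->
    pluecker_le (cols d) (cols a) ->
    (forall k, in_clique u v a k -> ~~ (u k <= elt (cols d) i0)%N) ->
  reducible (@XT_lt n m D) (@phi_fibre m n D) (@G K m n D r u v) p.
Proof.
move=> pd pa le_da low.
have [ia first_a] := ex_first_clique D_complex D_unit a.
have [id first_d] := ex_first_clique D_complex D_unit d.
have in_a : in_clique u v a ia by case/andP: first_a.
have in_d : in_clique u v d id by case/andP: first_d.
have out_d : ~~ in_clique u v d ia.
  by apply: contra (low ia in_a) => /in_cliqueP/(_ i0)/andP[].
have lt_i : (id < ia)%N.
  rewrite ltnNge; apply: contra (low ia in_a) => le_i.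
  have le_u := increasing_le (u_mono D_unit) le_i.
  by apply: leq_trans le_u _; have /in_cliqueP/(_ i0)/andP[] := in_d.
have gt_da : lex_gt (cols d) (cols a).
  have ne_da : val d != val a.
    by apply: contraNneq out_d => eq_da; rewrite /in_clique eq_da.
  by have := lex_gt_total ne_da; rewrite (negPf (pluecker_le_not_gt le_da)) orbF.
have cmp : comparable (cols d) (cols a) by rewrite /comparable le_da.
exists (diagT D (cols d) + Tv a)%MM, (diagT D (cols a) + Tv d)%MM; split.
- exact: lead_binom1.
- rewrite /phi_fibre !weightD !weight_diagT !weight_uvar addmC.
  by rewrite !TdegD !Tdeg_diagT !Tdeg_Tv.
- apply: Or31; exists d, a, id, ia; split=> //.
  by rewrite !R_in_RT_xmon !TRT_X !mpolyXD.
apply: expo_lepP => -[[i x]|b]; rewrite !expoE ?addn0.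
  by case: eqP => // <-; apply: pd.
by case: eqP => // <-.
Qed.

Lemma irreducible_standard p :
    ~ reducible (@XT_lt n m D) (@phi_fibre m n D) (@G K m n D r u v) p ->
  standard u v m_gt0 (x_part p) (T_part p).
Proof.
move=> irr; split=> [a b pa pb|a pa].
  apply/negPn/negP => incomp; exact: irr (incomparable_reducible pa pb incomp).
split=> [i x k px lt_x above le_x|d pd le_da].
  apply/negP => in_a; exact: irr (insertion_reducible px pa lt_x above le_x in_a).
have [/existsP[k /andP[in_a le_k]]|/existsPn none] :=
    boolP [exists k, in_clique u v a k && (u k <= elt (cols d) i0)%N].
  by exists k.
case: irr; apply: (binom1_reducible pd pa le_da) => k in_a.
by have := none k; rewrite in_a.
Qed.

Lemma psi_irreducible_standard p :
    ~ reducible (@T_lt n m D) (@psi_fibre m n D) (@G' K m n D) p ->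
  standard u v m_gt0 (fun _ _ => 0%N) (expo p).
Proof.
move=> irr; split=> [a b pa pb|a _]; last by split=> // d /(_ i0).
apply/negPn/negP => incomp; exact: irr (psi_incomparable_reducible pa pb incomp).
Qed.

Lemma phi_fibre_reducible p q : p != q -> phi_fibre p = phi_fibre q ->
  reducible (@XT_lt n m D) (@phi_fibre m n D) (@G K m n D r u v) p \/
  reducible (@XT_lt n m D) (@phi_fibre m n D) (@G K m n D r u v) q.
Proof.
move=> ne_pq eq_pq; apply: NNPP => /not_or_and[/irreducible_standard std_p].
move=> /irreducible_standard std_q; case/eqP: ne_pq.
have [||eq_x eq_T] := standard_unique D_complex D_unit _ _ std_p std_q.
- by case: eq_pq.
- by move=> i x; rewrite -!expo_phi_fibre eq_pq.
by apply: expoP => -[[i x]|a]; [apply: eq_x | apply: eq_T].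
Qed.

(** The number of factors T_a is the number of entries in the first row. *)
Lemma psi_fibre_reducible p q : p != q -> psi_fibre p = psi_fibre q ->
  reducible (@T_lt n m D) (@psi_fibre m n D) (@G' K m n D) p \/
  reducible (@T_lt n m D) (@psi_fibre m n D) (@G' K m n D) q.
Proof.
move=> ne_pq eq_pq; apply: NNPP => /not_or_and[/psi_irreducible_standard std_p].
move=> /psi_irreducible_standard std_q; case/eqP: ne_pq.
have eq_c i x : content (fun _ _ => 0%N) (expo p) i x = content (fun _ _ => 0%N) (expo q) i x.
  by rewrite -!expo_psi_fibre eq_pq.
have row0 (s : 'X_{1..#|facet m D|}) :
    (\sum_a expo s a = \sum_x content (fun _ _ => 0%N) (expo s) i0 x)%N.
  rewrite /content exchange_big /=; apply: eq_bigr => a _.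
  rewrite (bigD1 (elt (cols a) i0)) //= eqxx muln1 big1 ?addn0 // => x.
  by rewrite eq_sym => /negPf->; rewrite muln0.
have [|_ eq_T] := standard_unique D_complex D_unit _ eq_c std_p std_q.
  by rewrite !row0; apply: eq_bigr => x _.
exact: expoP.
Qed.

End Binomials.

(** * Initial terms of maximal minors *)

Section Minors.
Context (K : fieldType) (m n : nat).
Implicit Types (a : ksubset n m) (s : 'S_m).

Definition minor_mnm a s : 'X_{1..#|Xidx n m|} :=
  (\sum_(i < m) uvar ((i, elt a (s i)) : Xidx n m))%MM.

Lemma minor_expansion a : minor K a = \sum_(s : 'S_m) (-1) ^+ s * 'X_[minor_mnm a s].
Proof.
apply: eq_bigr => s _; rewrite mpolyX_sum; congr (_ * _).
by apply: eq_bigr => i _; rewrite mxE.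
Qed.

Lemma expo_minor_mnm a s i x : expo (minor_mnm a s) (i, x) = (elt a (s i) == x).
Proof.
rewrite expo_sum (bigD1 i) //= big1 ?addn0; first by rewrite xpair_eqE eqxx.
by move=> j ne_ji; rewrite xpair_eqE (negPf ne_ji).
Qed.

Lemma minor_mnm1 a : minor_mnm a 1%g = diag_mnm a.
Proof. by apply: eq_bigr => i _; rewrite perm1. Qed.

(** The first row moved by s is moved to a later column, that is, to a smaller
    variable. *)
Lemma minor_mnm_lt a s : s != 1%g -> x_lt (minor_mnm a s) (diag_mnm a).
Proof.
move=> ne_s1; have [i0 ne0] : exists i, s i != i.
  apply/existsP; apply: contraNT ne_s1 => /existsPn fix_s.
  by apply/eqP/permP => i; rewrite perm1; apply/eqP; have := fix_s i; rewrite negbK.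
case: (@arg_minnP _ i0 (fun i => s i != i) (@nat_of_ord m) ne0) => i ne_i min_i.
have fixed (j : 'I_m) : (j < i)%N -> s j = j.
  by move=> lt_ji; apply/eqP; apply: contraTT lt_ji => /min_i; rewrite -leqNgt.
have lt_i : (i < s i)%N.
  rewrite ltn_neqAle [(_ == _)%N]val_eqE eq_sym ne_i leqNgt.
  apply: contra ne_i => /fixed/perm_inj->; exact: eqxx.
have lt_elt := elt_inc a lt_i : (elt a i < elt a (s i))%N.
apply/existsP; exists (i, elt a i); rewrite expo_minor_mnm expo_diag eqxx.
rewrite -val_eqE /= gtn_eqF //=; apply/forallP => -[j x].
rewrite expo_minor_mnm expo_diag /x_gt /=.
apply/implyP => /orP[/fixed->//|/andP[/eqP-> lt_x]].
by rewrite -!val_eqE /= (gtn_eqF lt_x) (gtn_eqF (ltn_trans lt_x lt_elt)).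
Qed.

Lemma mcoeff_minor a p :
  (minor K a)@_p = \sum_(s : 'S_m) (-1) ^+ s * (minor_mnm a s == p)%:R.
Proof.
rewrite minor_expansion raddf_sum; apply: eq_bigr => s _ /=.
by rewrite -mpolyC1 -mpolyCN -rmorphXn /= mcoeffCM mcoeffX.
Qed.

Lemma x_lt_irr (p : 'X_{1..#|Xidx n m|}) : x_lt p p = false.
Proof. by apply/negbTE/existsPn => w; rewrite ltnn. Qed.

Lemma minor_lead a : leading_monomial (@x_lt n m) (minor K a) (diag_mnm a).
Proof.
split.
  rewrite mcoeff_msupp mcoeff_minor (bigD1 1%g) //= minor_mnm1 eqxx odd_perm1 mulr1.
  rewrite big1 ?addr0 ?oner_eq0 // => s /(minor_mnm_lt a) lt_s.
  case: eqP => [eq_s|_]; last by rewrite mulr0.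
  by rewrite eq_s x_lt_irr in lt_s.
move=> q; rewrite mcoeff_msupp mcoeff_minor => supp_q ne_q.
have [s /eqP eq_s] : exists s, minor_mnm a s == q.
  apply/existsP; apply: contraNT supp_q => /existsPn none.
  by rewrite big1 // => s _; rewrite (negPf (none s)) mulr0.
rewrite -eq_s minor_mnm_lt //; apply: contraNneq ne_q => s1.
by rewrite -eq_s s1 minor_mnm1.
Qed.

Lemma xmon_inJ (D : {set {set 'I_n}}) (a : facet m D) : inJ D (xmon K (cols a)).
Proof.
apply: ideal_gen_id; exists (minor K (cols a)), (diag_mnm (cols a)); split=> //.
  by apply: ideal_gen_id; exists a.
exact: minor_lead.
Qed.

End Minors.

(** * Evaluating the free algebra that carries the symmetric algebra *)

(** The monomials in the symbols e_a are exponent functions of finite support; the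
    universal property of the free algebra is obtained by evaluating them. *)
Module SymEval.
Import finmap monalg.
Section SymEval.
Context (A B : comNzRingType) (f : {rmorphism A -> B}) (w : A -> B).

Definition monval (p : {cmonom A}) : B := \prod_(a <- finsupp p) w a ^+ p a.

Lemma monvalEw (p : {cmonom A}) (d : {fset A}) : (finsupp p `<=` d)%fset ->
  monval p = \prod_(a <- d) w a ^+ p a.
Proof.
move=> le_pd; rewrite /monval (big_fset_incl _ le_pd) // => a _.
by rewrite -cmE_neq0 negbK => /eqP->; rewrite expr0.
Qed.

Lemma monval_mmorphism : mmorphism monval.
Proof.
split=> [p q|]; last by rewrite /monval mdom1 big_seq_fset0.
rewrite (monvalEw (d := (finsupp p `|` finsupp q)%fset)) ?mdomD //.
rewrite (monvalEw (fsubsetUl (finsupp p) (finsupp q))).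
rewrite (monvalEw (fsubsetUr (finsupp p) (finsupp q))) -big_split /=.
by apply: eq_bigr => a _; rewrite cmM exprD.
Qed.

HB.instance Definition _ :=
  monalg.isMultiplicative.Build {cmonom A} B monval monval_mmorphism.

Definition eval : {rmorphism Sym.free A -> B} := mmap f monval.

Lemma eval_e a : eval (Sym.e a) = w a.
Proof.
transitivity (f 1 * monval (ucm a)); first exact: mmapU.
rewrite rmorph1 mul1r /monval mdomU big_seq_fset1.
by rewrite cmUU expr1.
Qed.

Lemma evalZ a g : eval (a *: g) = f a * eval g.
Proof. exact: mmapZ. Qed.

Lemma eval0 : eval 0 = 0. Proof. exact: rmorph0. Qed.

Lemma evalD g h : eval (g + h) = eval g + eval h.
Proof. exact: rmorphD. Qed.

Lemma evalB g h : eval (g - h) = eval g - eval h.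
Proof. exact: rmorphB. Qed.

Lemma evalM g h : eval (g * h) = eval g * eval h.
Proof. exact: rmorphM. Qed.

Lemma eval_alg a : eval a%:A = f a.
Proof. by rewrite evalZ rmorph1 mulr1. Qed.

Lemma eval_linearity a x y :
  eval (Sym.e (a * x + y) - a *: Sym.e x - Sym.e y) = w (a * x + y) - f a * w x - w y.
Proof. by rewrite 2!evalB evalZ; congr (_ - f a * _ - _); exact: eval_e. Qed.

End SymEval.
End SymEval.

Lemma rmorph_mmap (N : nat) (K : nzRingType) (A B : comNzRingType)
    (F : {rmorphism A -> B}) (c : K -> A) (h : 'I_N -> A) p :
  F (mmap c h p) = mmap (F \o c) (F \o h) p.
Proof.
rewrite /mmap rmorph_sum; apply: eq_bigr => q _; rewrite rmorphM rmorph_prod /=.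
by congr (_ * _); apply: eq_bigr => k _; rewrite rmorphXn.
Qed.

(** * The symmetric algebra and the syzygies *)

Section FiberType.
Context (K : fieldType) (m n : nat) (D : {set {set 'I_n}}).
Local Notation RT := (RT K m D).
Local Notation KT := (KT K m D).
Local Notation R := (R K m n).
Local Notation inJ := (@inJ K m n D).
Implicit Types (a b c d : facet m D).

(** Image of the symbol e_u under the map from the symmetric algebra to the Rees
    algebra.  The symbols of elements outside of the ideal vanish in the symmetric
    algebra, which forces the case distinction. *)
Definition sym_to_rees_symbol (w : R) : {poly R} :=
  if excluded_middle_informative (inJ w) then w%:P * 'X else 0.

Lemma sym_to_rees_relation (g : Sym.free R) : Sym.eq0 inJ g ->
  SymEval.eval polyC sym_to_rees_symbol g = 0.
Proof.
have in_e w : inJ w -> sym_to_rees_symbol w = w%:P * 'X.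
  by rewrite /sym_to_rees_symbol; case: (excluded_middle_informative (inJ w)).
apply: (@ideal_gen_ind _ _ (fun g => SymEval.eval polyC sym_to_rees_symbol g = 0)).
- exact: SymEval.eval0.
- by move=> g1 g2 z1 z2; rewrite SymEval.evalD z1 z2 addr0.
move=> g1 g2 [[w out_w ->]|[s [x [y [Ix Iy ->]]]]].
  rewrite SymEval.evalM SymEval.eval_e /sym_to_rees_symbol.
  by case: (excluded_middle_informative (inJ w)) => [/out_w//|_] /=; rewrite mulr0.
have Jxy : inJ (s * x + y) by apply: ideal_genD => //; apply: ideal_genMl.
rewrite SymEval.evalM.
rewrite SymEval.eval_linearity.
rewrite (in_e _ Jxy) (in_e _ Ix) (in_e _ Iy).
by rewrite polyCD polyCM mulrDl mulrA [X in X - _]addrAC subrr add0r subrr mulr0.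
Qed.

Lemma sym_to_rees (f : RT) :
  SymEval.eval polyC sym_to_rees_symbol (to_sym f) = phi f.
Proof.
rewrite /to_sym /phi /subst rmorph_mmap; apply: eq_bigr => q _.
congr (_ * _); first exact: SymEval.eval_alg.
apply: eq_bigr => k _; congr (_ ^+ _); rewrite /comp.
case: (enum_val k) => [ix|a]; first exact: SymEval.eval_alg.
rewrite SymEval.eval_e /sym_to_rees_symbol.
case: (excluded_middle_informative _) => [//|out]; case: out.
exact: xmon_inJ.
Qed.

Lemma L_ker (f : RT) : L f -> ker_phi f.
Proof. by move=> /sym_to_rees_relation; rewrite sym_to_rees. Qed.

Lemma to_symD (f g : RT) : to_sym (f + g) = to_sym f + to_sym g.
Proof. exact: rmorphD. Qed.

Lemma to_symM (f g : RT) : to_sym (f * g) = to_sym f * to_sym g.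
Proof. exact: rmorphM. Qed.

Lemma to_symB (f g : RT) : to_sym (f - g) = to_sym f - to_sym g.
Proof. exact: rmorphB. Qed.

Lemma L0 : L (0 : RT).
Proof.
rewrite /L (_ : to_sym 0 = 0); first exact: ideal_gen0.
exact: rmorph0.
Qed.

Lemma LD (f g : RT) : L f -> L g -> L (f + g).
Proof. by rewrite /L to_symD; apply: ideal_genD. Qed.

Lemma LM (f g : RT) : L g -> L (f * g).
Proof. by rewrite /L to_symM; apply: ideal_genMl. Qed.

Lemma subr_cancel (V : zmodType) (c a b z : V) :
  a - b = (c - b - z) - (c - a - z).
Proof. by rewrite opprB addrA subrK opprB addrC addrA subrK. Qed.

(** Both r e_x and s e_y equal e_(r x) in the symmetric algebra; the auxiliary
    symbol e_0 comes from using the linearity relation with v = 0. *)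
Lemma sym_syzygy (r s x y : R) : inJ x -> inJ y -> r * x = s * y ->
  Sym.eq0 inJ (r *: Sym.e x - s *: Sym.e y).
Proof.
move=> Jx Jy eq_rs; have J0 : inJ 0 by apply: ideal_gen0.
have rel t z : inJ z ->
    Sym.eq0 inJ (Sym.e (t * z + 0) - t *: Sym.e z - Sym.e 0).
  by move=> Jz; apply: ideal_gen_id; right; exists t, z, 0.
rewrite (subr_cancel (Sym.e (s * y + 0)) _ _ (Sym.e 0)) -{2}eq_rs.
by apply: ideal_genD; [|apply: ideal_genN]; apply: rel.
Qed.

Lemma to_sym_TRT a : to_sym (TRT K a) = Sym.e (xmon K (cols a)).
Proof. by rewrite TRT_X /to_sym /subst mmapX mmap1U enum_rankK. Qed.

Lemma to_sym_xRT (i : 'I_m) (x : 'I_n) : to_sym (xRT K D i x) = (x_ K i x)%:A.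
Proof. by rewrite xRT_X /to_sym /subst mmapX mmap1U enum_rankK. Qed.

Lemma to_sym_xmon (s : ksubset n m) :
  to_sym (R_in_RT D (xmon K s)) = (xmon K s)%:A.
Proof.
rewrite R_in_RT_xmon /diagT mpolyX_sum /to_sym /subst rmorph_prod /=.
rewrite /xmon /diag_mnm mpolyX_sum -in_algE rmorph_prod.
by apply: eq_bigr => i _; rewrite mmapX mmap1U enum_rankK.
Qed.

Lemma to_sym_scale (f : RT) (x : R) a : to_sym f = x%:A ->
  to_sym (f * TRT K a) = x *: Sym.e (xmon K (cols a)).
Proof.
move=> fx; transitivity (to_sym f * to_sym (TRT K a)); first exact: to_symM.
transitivity (x%:A * Sym.e (xmon K (cols a))); last exact: mulr_algl.
congr (_ * _); first exact: fx.
exact: to_sym_TRT.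
Qed.

Lemma L_syzygy (f g : RT) (x y : R) a b :
    to_sym f = x%:A -> to_sym g = y%:A ->
    x * xmon K (cols a) = y * xmon K (cols b) ->
  L (f * TRT K a - g * TRT K b).
Proof.
move=> fx gy eq_xy; have Jab := sym_syzygy (xmon_inJ K a) (xmon_inJ K b) eq_xy.
apply: eq_ind Jab _ _; symmetry; transitivity (to_sym (f * TRT K a) - to_sym (g * TRT K b)).
  exact: to_symB.
by congr (_ - _); apply: to_sym_scale.
Qed.

End FiberType.

(** * The Gröbner bases and the fiber type property *)

Section Assembly.
Context (K : fieldType) (m n : nat) (D : {set {set 'I_n}}).
Context (r : nat) (u v : 'I_r.+1 -> 'I_n).
Hypothesis m_gt0 : (0 < m)%N.
Hypothesis D_complex : simplicial_complex D.
Hypothesis D_unit : unit_interval m D u v.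
Local Notation RT := (RT K m D).
Local Notation KT := (KT K m D).
Local Notation R := (R K m n).
Local Notation G := (@G K m n D r u v).
Local Notation G' := (@G' K m n D).
Implicit Types (a b c d : facet m D).

Lemma G_finite : exists s : seq RT, forall g, G g -> g \in s.
Proof.
pose F1 (x : facet m D * facet m D) : RT :=
  R_in_RT D (xmon K (cols x.1)) * TRT K x.2 - R_in_RT D (xmon K (cols x.2)) * TRT K x.1.
pose F2 (x : ksubset n m.+1 * 'I_m * facet m D * facet m D) : RT :=
  let: (c, i, p, q) := x in
  xRT K D i (elt c (widen_ord (leqnSn m) i)) * TRT K p
  - xRT K D i (elt c (lift ord0 i)) * TRT K q.
pose F3 (x : facet m D * facet m D * facet m D * facet m D) : RT :=
  let: (a, b, c, d) := x in TRT K a * TRT K b - TRT K c * TRT K d.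
exists (codom F1 ++ codom F2 ++ codom F3) => g.
rewrite !mem_cat; case.
- move=> /binom1E[a [b [_ _ ->]]].
  by rewrite (codom_f F1 (a, b)).
- move=> /binom2E[c [i [p [q [_ _ ->]]]]].
  by rewrite (codom_f F2 (c, i, p, q)) orbT.
move=> /binom3E[a [b [c [d [_ _ _ ->]]]]].
by rewrite (codom_f F3 (a, b, c, d)) !orbT.
Qed.

Lemma G'_finite : exists s : seq KT, forall g, G' g -> g \in s.
Proof.
pose F (x : facet m D * facet m D * facet m D * facet m D) : KT :=
  let: (a, b, c, d) := x in T_ K a * T_ K b - T_ K c * T_ K d.
exists (codom F) => g /binom3E[a [b [c [d [_ _ _ ->]]]]].
exact: (codom_f F (a, b, c, d)).
Qed.

Lemma groebner_phi : groebner_basis (@XT_lt n m D) G (@ker_phi K m n D).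
Proof.
apply: (groebner_of_fibres (pi := @phi_fibre m n D)).
- exact: degrevlex_irr.
- exact: degrevlex_trans (@XT_gt_total _ _ _) (@XT_gt_trans _ _ _).
- exact: degrevlex_deg.
- exact: degrevlex_add.
- exact: phi_fibre_add.
- exact: G_fibre.
- exact: phi_kernel_fibre.
- exact: phi_support.
- exact: phi_fibre_reducible.
exact: G_finite.
Qed.

Lemma groebner_psi : groebner_basis (@T_lt n m D) G' (@ker_psi K m n D).
Proof.
apply: (groebner_of_fibres (pi := @psi_fibre m n D)).
- exact: degrevlex_irr.
- exact: degrevlex_trans (@T_gt_total _ _ _) (@T_gt_trans _ _ _).
- exact: degrevlex_deg.
- exact: degrevlex_add.
- exact: psi_fibre_add.
- exact: (binom3_psi_fibre D_complex D_unit).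
- exact: psi_kernel_fibre.
- exact: psi_support.
- exact: (psi_fibre_reducible K m_gt0 D_complex D_unit).
exact: G'_finite.
Qed.

Lemma ker_phi_gen (f : RT) : ker_phi f -> ideal_gen G f.
Proof.
apply: (gen_of_fibres (lt := @XT_lt n m D) (pi := @phi_fibre m n D)).
- exact: degrevlex_irr.
- exact: degrevlex_trans (@XT_gt_total _ _ _) (@XT_gt_trans _ _ _).
- exact: degrevlex_deg.
- exact: degrevlex_add.
- exact: phi_fibre_add.
- by move=> g h g0 h0; rewrite /ker_phi phiD g0 h0 addr0.
- by move=> g h h0; rewrite /ker_phi phiM h0 mulr0.
- exact: phi_kernel_fibre.
- exact: phi_support.
exact: phi_fibre_reducible.
Qed.

Lemma psiD (f g : KT) : psi (f + g) = psi f + psi g.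
Proof. exact: rmorphD. Qed.

Lemma psiM (f g : KT) : psi (f * g) = psi f * psi g.
Proof. exact: rmorphM. Qed.

Lemma ker_psi_gen (f : KT) : ker_psi f -> ideal_gen G' f.
Proof.
apply: (gen_of_fibres (lt := @T_lt n m D) (pi := @psi_fibre m n D)).
- exact: degrevlex_irr.
- exact: degrevlex_trans (@T_gt_total _ _ _) (@T_gt_trans _ _ _).
- exact: degrevlex_deg.
- exact: degrevlex_add.
- exact: psi_fibre_add.
- by move=> g h g0 h0; rewrite /ker_psi psiD g0 h0 addr0.
- by move=> g h h0; rewrite /ker_psi psiM h0 mulr0.
- exact: psi_kernel_fibre.
- exact: psi_support.
exact: (psi_fibre_reducible K m_gt0 D_complex D_unit).
Qed.

Lemma G_ker (f : RT) : G f -> ker_phi f.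
Proof. by case: groebner_phi => _ + _; apply. Qed.

Lemma KT_in_RTD (f g : KT) : KT_in_RT (f + g) = KT_in_RT f + KT_in_RT g.
Proof. exact: rmorphD. Qed.

Lemma KT_in_RTM (f g : KT) : KT_in_RT (f * g) = KT_in_RT f * KT_in_RT g.
Proof. exact: rmorphM. Qed.

Lemma KT_in_RTB (f g : KT) : KT_in_RT (f - g) = KT_in_RT f - KT_in_RT g.
Proof. exact: rmorphB. Qed.

(** ker psi* is homogeneous in the T_a, being generated by the binomials of
    the third kind. *)
Lemma ker_psi_in_ker_phi (p : KT) : ker_psi p -> ker_phi (KT_in_RT p).
Proof.
move=> /ker_psi_gen; rewrite /ker_phi.
apply: (@ideal_gen_ind _ _ (fun p => phi (KT_in_RT p) = 0)).
- by rewrite /KT_in_RT /incl /subst /phi /subst !rmorph0.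
- by move=> g h g0 h0; rewrite KT_in_RTD phiD g0 h0 addr0.
move=> g h /binom3E[a [b [c [d [incomp val_c val_d ->]]]]].
rewrite KT_in_RTM phiM KT_in_RTB !KT_in_RTM [X in _ * X]G_ker ?mulr0 //.
by apply: Or33; apply/binom3E; exists a, b, c, d.
Qed.

Lemma binom1_L (f : RT) : binom1 u v f -> L f.
Proof.
move=> /binom1E[a [b [_ _ ->]]].
by apply: L_syzygy; rewrite ?to_sym_xmon // mulrC.
Qed.

Lemma binom2_L (f : RT) : binom2 u v f -> L f.
Proof.
move=> /binom2E[c [i [p [q [val_p val_q ->]]]]].
apply: L_syzygy; rewrite ?to_sym_xRT //.
have := congr1 fst (exchange_fibre val_p val_q).
rewrite /phi_fibre !weightD !weight_uvar /= => eq_w.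
by rewrite /x_ /var /xmon -!mpolyXD -!/(uvar _) eq_w.
Qed.

Lemma fiber_type_initial_ideal : fiber_type K m D.
Proof.
move=> f; split=> [/ker_phi_gen | [g [h [Lg Ih ->]]]].
  set fib := ideal_gen (fun q => exists2 p, _ & _).
  apply: (@ideal_gen_ind _ _ (fun f => exists g h, [/\ L g, fib h & f = g + h])).
  - by exists 0, 0; split; [exact: L0 | exact: ideal_gen0 | rewrite addr0].
  - move=> _ _ [g1 [h1 [L1 I1 ->]]] [g2 [h2 [L2 I2 ->]]].
    exists (g1 + g2), (h1 + h2).
    by split; [exact: LD | exact: ideal_genD | exact: addrACA].
  move=> g h [/binom1_L Lh | /binom2_L Lh | /binom3E B3].
  - by exists (g * h), 0; split; [exact: LM | exact: ideal_gen0 | rewrite addr0].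
  - by exists (g * h), 0; split; [exact: LM | exact: ideal_gen0 | rewrite addr0].
  exists 0, (g * h); split; [exact: L0 | | by rewrite add0r].
  apply/ideal_genMl/ideal_gen_id; have [a [b [c [d [incomp val_c val_d ->]]]]] := B3.
  exists (T_ K a * T_ K b - T_ K c * T_ K d); last by rewrite KT_in_RTB !KT_in_RTM.
  case: groebner_psi => _ + _; apply.
  by apply/binom3E; exists a, b, c, d.
rewrite /ker_phi phiD (L_ker Lg) add0r.
move: Ih; apply: (@ideal_gen_ind _ _ (fun h => phi h = 0)).
- exact: rmorph0.
- by move=> g1 g2 z1 z2; rewrite phiD z1 z2 addr0.
by move=> g1 _ [p /ker_psi_in_ker_phi p0 ->]; rewrite phiM p0 mulr0.
Qed.

End Assembly.

Theorem theorem3p14 (K : fieldType) (m n : nat) (D : {set {set 'I_n}})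
    (r : nat) (u v : 'I_r.+1 -> 'I_n) :
  (0 < m)%N -> (m <= n)%N ->
  simplicial_complex D ->
  pure m D ->
  unit_interval m D u v ->
  [/\ groebner_basis (@XT_lt n m D) (@G K m n D r u v) (@ker_phi K m n D),
      groebner_basis (@T_lt n m D) (@G' K m n D) (@ker_psi K m n D)
    & @fiber_type K m n D].
Proof.
move=> m_gt0 _ D_complex _ D_unit; split.
- exact: groebner_phi.
- exact: groebner_psi D_complex D_unit.
exact: fiber_type_initial_ideal D_complex D_unit.
Qed.
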